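(* For $n\ge0$ let $B_n$ be a random variable uniformly distributed over the boolean intervals of $\mathbb{F}_n^\infty$, and let $X_n$ be the height of $B_n$. Then $$\frac{4X_n-(2-\sqrt2)\,n}{\sqrt n\,\sqrt[4]{2}}$$ converges in law to a standard normal distribution as $n\to\infty$.
   Context: A Dyck path of semilength $n\ge 0$ is a lattice path from $(0,0)$ to $(2n,0)$ with steps $U=(1,1)$ and $D=(1,-1)$ that never goes below the $x$-axis; it is identified with its word over $\{U,D\}$. A path avoids a pattern $\alpha$ if $\alpha$ does not occur as a factor (block of consecutive steps). $\mathcal{F}_n^\infty$ is the set of Dyck paths of semilength $n$ avoiding $DUU$, ordered by the Stanley order: $P\le Q$ iff $P$ lies weakly below $Q$ when both are drawn in the plane; $\mathbb{F}_n^\infty=(\mathcal{F}_n^\infty,\le)$. An interval is $[P,Q]=\{R:P\le R\le Q\}$ for $P\le Q$ (including $P=Q$); its height is the length of a maximal chain from $P$ to $Q$; it is boolean if it is isomorphic to the lattice of subsets of a finite set. *)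

(* Defs.v *)
From HB Require Import structures.
From mathcomp Require Import all_boot all_order all_algebra.
From mathcomp Require Import all_classical all_reals all_analysis.
Set Implicit Arguments.
Unset Strict Implicit.
Unset Printing Implicit Defensive.
Import Order.TTheory GRing.Theory Num.Theory.
Import numFieldNormedType.Exports.
Local Open Scope ring_scope.

(* Steps are booleans: true is U = (1, 1) and false is D = (1, -1). *)
Local Notation U := true (only parsing).
Local Notation D := false (only parsing).

Definition ordinate (w : seq bool) (i : nat) : int :=
  \sum_(s <- take i w) (if s is U then 1 else -1).

Definition is_dyck (n : nat) (w : (n.*2).-tuple bool) : bool :=
  [forall i : 'I_(n.*2).+1, 0 <= ordinate w i] && (ordinate w n.*2 == 0).

Definition dyck (n : nat) : Type := {w : (n.*2).-tuple bool | is_dyck w}.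
HB.instance Definition _ n := SubType.on (dyck n).
HB.instance Definition _ n := Finite.on (dyck n).

(* Both paths are linear between consecutive integer abscissas, so it is
   enough to compare their ordinates there. *)
Definition stanley_le (n : nat) (P Q : dyck n) : bool :=
  [forall i : 'I_(n.*2).+1, ordinate (val P) i <= ordinate (val Q) i].

Definition stanley_lt (n : nat) (P Q : dyck n) : bool :=
  (Q != P) && stanley_le P Q.

Lemma ordinateS (w : seq bool) (i : nat) : (i < size w)%N ->
  ordinate w i.+1 = ordinate w i + (if nth D w i is U then 1 else -1).
Proof.
by move=> iw; rewrite /ordinate (take_nth D iw) -cats1 big_cat big_seq1.
Qed.

Lemma stanley_le_refl n : reflexive (@stanley_le n).
Proof. by move=> P; apply/forallP => i. Qed.

Lemma stanley_le_anti n : antisymmetric (@stanley_le n).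
Proof.
move=> P Q /andP[/forallP PQ /forallP QP].
have e k : (k <= n.*2)%N -> ordinate (val P) k = ordinate (val Q) k.
  by rewrite -ltnS => kn; apply/le_anti; rewrite (PQ (Ordinal kn)) (QP (Ordinal kn)).
apply/val_inj/val_inj/(@eq_from_nth _ D); rewrite ?size_tuple// => i ilt.
have := e _ ilt; rewrite !ordinateS ?size_tuple// (e _ (ltnW ilt)) => /addrI.
by case: (nth D _ i); case: (nth D _ i).
Qed.

Lemma stanley_le_trans n : transitive (@stanley_le n).
Proof.
move=> Q P S /forallP PQ /forallP QS; apply/forallP => i.
exact: le_trans (PQ i) (QS i).
Qed.

Fact stanley_display : Order.disp_t. Proof. exact: Order.Disp tt tt. Qed.

HB.instance Definition _ n := Order.isPOrder.Build stanley_display (dyck n)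
  (fun _ _ => erefl) (@stanley_le_refl n) (@stanley_le_anti n)
  (@stanley_le_trans n).

Definition avoids (pat : seq bool) (n : nat) (P : dyck n) : bool :=
  ~~ infix pat (val P).

Definition Finf (n : nat) : Type := {P : dyck n | avoids [:: D; U; U] P}.
HB.instance Definition _ n := SubType.on (Finf n).
HB.instance Definition _ n := Finite.on (Finf n).
HB.instance Definition _ n :=
  [SubChoice_isSubPOrder of Finf n by <: with stanley_display].

Section Intervals.
Context {disp : Order.disp_t} {T : finPOrderType disp}.

Definition segment (p q : T) : {set T} := [set r | (p <= r <= q)%O].

Definition is_interval (I : {set T}) : Prop :=
  exists p q : T, (p <= q)%O /\ I = segment p q.

Definition is_chain (C : {set T}) : bool :=
  [forall p in C, forall q in C, (p >=< q)%O].

(* The length of a chain is its cardinality minus one.  When I is a graded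
   poset (for instance a boolean interval) all its maximal chains have the same
   length, and the maximum below is that common value. *)
Definition height (I : {set T}) : nat :=
  \max_(C : {set T} | maxset (fun K => is_chain K && (K \subset I)) C) #|C|.-1.

Definition is_boolean (I : {set T}) : Prop :=
  exists (S : finType) (f : {set S} -> T),
    {mono f : A B / A \subset B >-> (A <= B)%O} /\ f @: [set: {set S}] = I.

End Intervals.

Definition boolean_intervals {disp : Order.disp_t} (T : finPOrderType disp) :
    {set {set T}} :=
  [set I : {set T} | `[< is_interval I /\ is_boolean I >]].

Local Open Scope classical_set_scope.

(* Finite sets, with the discrete sigma-algebra. *)
HB.instance Definition _ (T : finType) := isPointed.Build {set T} finset.set0.
HB.instance Definition _ (T : finType) :=
  @isMeasurable.Build default_measure_display {set T} discrete_measurable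
    discrete_measurable0 discrete_measurableC discrete_measurableU.

Section RandomFiniteSets.
Context {d : measure_display} {T : measurableType d} {R : realType}
  {S : finType}.

Definition uniform_over (P : probability T R) (B : {RV P >-> {set S}})
    (E : {set {set S}}) : Prop :=
  forall I : {set S},
    distribution P B [set I] = ((I \in E)%:R / #|E|%:R : R)%:E.

Lemma measurable_rv_map (B : {mfun T >-> {set S}}) (f : {set S} -> R) :
  measurable_fun [set: T] (f \o B).
Proof. by apply: (measurableT_comp _ (measurable_funPT B)) => _ A _. Qed.

(* The random variable f(B). *)
Definition rv_map (P : probability T R) (B : {RV P >-> {set S}})
    (f : {set S} -> R) : {RV P >-> R} :=
  mfun_Sub (mem_set (measurable_rv_map B f)).

End RandomFiniteSets.

(* Convergence in law of real random variables, possibly defined on different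
   probability spaces: the distribution functions converge at every point of
   continuity of the limiting distribution function. *)
Definition cvg_in_law {R : realType} {d : nat -> measure_display}
    {T : forall n, measurableType (d n)} {P : forall n, probability (T n) R}
    (Y : forall n, {RV (P n) >-> R}) (mu : probability (measurableTypeR R) R) : Prop :=
  forall x : R, {for x, continuous (fun t : R => mu `]-oo, t])} ->
    cdf (Y n) x @[n --> \oo] --> mu `]-oo, x].

(* Main.v *)
(** A DUU-avoiding Dyck path of semilength N + 1 is U^c D followed by N blocks,
    each D or UD, hence is a word of length N; its successive ordinates after
    the steps D count the D blocks still to come, and the Stanley order compares
    these suffix counts pointwise.  Going up by one at a single position
    ("site") rewrites D,UD into UD,D (or an initial UD block into D), and sites
    of a word do not interfere.  The boolean intervals are therefore the pairs
    (word p, set A of sites of p), with height #|A|.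

    With n = N + 1, the number A_k of those of height k satisfies
      2 (n - k) A_k = n C(n - k, k) 2^(n - 2k),
    so that A_(k+1) / A_k = (n - 2k)(n - 2k - 1) / (4 (k + 1)(n - k - 1)).
    For k = mu n + y with mu = (2 - sqrt 2) / 4, this ratio is
    1 - 8 sqrt 2 y / n + O(1/n) when y = O(sqrt n), which yields the local limit
    A_k / A_m -> exp(- t^2 / 2) at k = mu n + t sigma sqrt n, where m = floor(mu n)
    and sigma = 2^(1/4) / 4, while a crude bound on all ratios yields
    A_k / A_m <= C exp(- y^2 / n).  Integrating the associated step functions by
    dominated convergence gives the convergence of the distribution functions. *)

Require Import Defs.
From HB Require Import structures.
From mathcomp Require Import boolp.
From mathcomp Require Import all_boot all_order all_algebra.
From mathcomp Require Import zify ring lra.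
Set Implicit Arguments.
Unset Strict Implicit.
Unset Printing Implicit Defensive.
Import Order.TTheory GRing.Theory Num.Theory.

(** * Boolean intervals *)

Section HeightBoolean.
Local Open Scope nat_scope.
Context {disp : Order.disp_t} {T : finPOrderType disp} {N : nat}.
(** [eta] embeds the poset into N-tuples of naturals with the product order, and [flip p A] raises
    by one the coordinates in a set [A] of sites. By [site_lt], going up from [p] always raises some
    site, so the covers of [p] are flips at a single site. *)
Variables (eta : T -> 'I_N -> nat) (site : T -> {set 'I_N})
  (flip : T -> {set 'I_N} -> T).
Hypothesis le_eta : forall p q, (p <= q)%O = [forall j, eta p j <= eta q j].
Hypothesis eta_flip : forall p (A : {set 'I_N}), A \subset site p ->
  forall j, eta (flip p A) j = eta p j + (j \in A).
Hypothesis site_lt : forall p q, (p < q)%O ->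
  exists2 j, j \in site p & eta p j < eta q j.

Lemma eta_inj p q : eta p =1 eta q -> p = q.
Proof.
move=> e; apply/le_anti; rewrite !le_eta.
by apply/andP; split; apply/forallP => j; rewrite e.
Qed.

Lemma flip_le p (A B : {set 'I_N}) : A \subset site p -> B \subset site p ->
  (flip p A <= flip p B)%O = (A \subset B).
Proof.
move=> As Bs; rewrite le_eta; apply/forallP/subsetP => [h j jA|h j].
  by have := h j; rewrite !eta_flip// jA leq_add2l; case: (j \in B).
by rewrite !eta_flip// leq_add2l; have := h j; case: (j \in A) => // ->.
Qed.

Lemma flip0 p : flip p set0 = p.
Proof. by apply: eta_inj => j; rewrite eta_flip ?sub0set// inE addn0. Qed.

Lemma le_flip p (A : {set 'I_N}) : A \subset site p -> (p <= flip p A)%O.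
Proof. by move=> As; rewrite -{1}(flip0 p) flip_le ?sub0set. Qed.

Lemma flip_inj p (A B : {set 'I_N}) : A \subset site p -> B \subset site p ->
  flip p A = flip p B -> A = B.
Proof.
move=> As Bs e; apply/eqP.
by rewrite eqEsubset -(flip_le As Bs) -(flip_le Bs As) e lexx.
Qed.

(** On such a segment [eta r] lies between [eta p] and [eta p] plus the indicator of [A], so [r] is
    determined by the set of coordinates where it exceeds [p]. *)
Lemma segment_flipP p (A : {set 'I_N}) r : A \subset site p ->
  reflect (exists2 B : {set 'I_N}, B \subset A & r = flip p B)
    (r \in segment p (flip p A)).
Proof.
move=> As; rewrite inE; apply: (iffP andP) => [[pr rA]|[B BA ->]]; last first.
  have Bs := subset_trans BA As.
  by rewrite le_flip// flip_le.
exists [set j | eta p j < eta r j].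
  apply/subsetP => j; rewrite inE => pj; move: rA; rewrite le_eta => /forallP/(_ j).
  by rewrite eta_flip//; case: (j \in A) => //; lia.
apply: eta_inj => j; rewrite eta_flip; last first.
  apply/subsetP => i; rewrite inE => pj; apply: (subsetP As).
  move: rA; rewrite le_eta => /forallP/(_ i).
  by rewrite eta_flip//; case: (i \in A) => //; lia.
rewrite inE; move: rA pr; rewrite !le_eta => /forallP/(_ j) + /forallP/(_ j).
by rewrite eta_flip//; case: (j \in A) => /=; case: ltnP => /=; lia.
Qed.

Lemma segment_inj (p q p' q' : T) : (p <= q)%O -> (p' <= q')%O ->
  segment p q = segment p' q' -> p = p' /\ q = q'.
Proof.
move=> pq pq' /setP e.
have /esym := e p; have := e p'; have /esym := e q; have := e q'.
rewrite !inE !lexx pq pq' /= => /andP[_ a] /andP[_ b] /andP[c _] /andP[d _].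
by split; apply/le_anti; rewrite ?a ?b ?c ?d.
Qed.

Lemma segment_flip_inj p p' (A A' : {set 'I_N}) :
  A \subset site p -> A' \subset site p' ->
  segment p (flip p A) = segment p' (flip p' A') -> (p, A) = (p', A').
Proof.
move=> As As' /segment_inj[]; rewrite ?le_flip// => ep.
by move: As'; rewrite -ep => As' /(flip_inj As As') ->.
Qed.

Lemma segment_flip_boolean p (A : {set 'I_N}) : A \subset site p ->
  is_boolean (segment p (flip p A)).
Proof.
move=> As; pose S := {j : 'I_N | j \in A}.
pose g (B : {set S}) : {set 'I_N} := val @: B.
have gA B : g B \subset A.
  by apply/subsetP => _ /imsetP[j _ ->]; exact: (valP j).
have gs B := subset_trans (gA B) As.
exists S, (fun B => flip p (g B)); split.
  move=> B C; rewrite flip_le//; apply/subsetP/subsetP => h j.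
    by move=> jB; have /imsetP[i iC /val_inj->] := h _ (imset_f val jB).
  by move=> /imsetP[i iB ->]; apply/imset_f/h.
apply/setP => r; apply/imsetP/segment_flipP => // -[B].
  by move=> _ ->; exists (g B).
move=> BA ->; exists [set j : S | val j \in B] => //; congr flip.
apply/setP => j; apply/idP/imsetP => [jB|[i]]; last by rewrite inE => ? ->.
by exists (Sub j (subsetP BA _ jB)); rewrite ?inE SubK.
Qed.

(** Each [f [set s]] lies above some [flip p [set j]] by [site_lt]; the latter belongs to the
    segment and is not [p], so the two agree. If [A] is the set of these sites, [flip p A] is some
    [f B] above every [f [set s]], which forces [B] to be full. *)
Lemma boolean_flip p q : (p <= q)%O -> is_boolean (segment p q) ->
  exists2 A : {set 'I_N}, A \subset site p & q = flip p A.
Proof.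
move=> pq [S [f [fm fI]]].
have fpq B : (p <= f B <= q)%O.
  by have : f B \in segment p q; [rewrite -fI imset_f ?inE | rewrite inE].
have segP r : (p <= r <= q)%O -> exists B, r = f B.
  move=> rpq; have : r \in f @: [set: {set S}] by rewrite fI inE.
  by case/imsetP => B _ ->; exists B.
have f0 : f set0 = p.
  apply/le_anti; have [|B eB] := segP p; first by rewrite lexx pq.
  by rewrite {1}eB fm sub0set; case/andP: (fpq set0) => ->.
have fT : f [set: S] = q.
  apply/le_anti; have [|B eB] := segP q; first by rewrite lexx pq.
  by rewrite {2}eB fm subsetT andbT; case/andP: (fpq [set: S]) => _ ->.
have atom s : exists j, j \in site p /\ f [set s] = flip p [set j].
  have pfs : (p < f [set s])%O.
    rewrite lt_neqAle; case/andP: (fpq [set s]) => -> _; rewrite andbT.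
    apply/negP => /eqP e; have := fm [set s] set0.
    by rewrite f0 e lexx => /esym; rewrite subset0 -cards_eq0 cards1.
  have [j js jlt] := site_lt pfs; exists j; split => //.
  have j1 : [set j] \subset site p by rewrite sub1set.
  have jle : (flip p [set j] <= f [set s])%O.
    rewrite le_eta; apply/forallP => i; rewrite eta_flip// inE.
    have [->|] := eqVneq i j; first by rewrite addn1.
    by rewrite addn0 => _; move: i; apply/forallP; rewrite -le_eta ltW.
  have [B eB] : exists B, flip p [set j] = f B.
    apply: segP; rewrite le_flip//=; apply: le_trans jle _.
    by case/andP: (fpq [set s]).
  move: (jle); rewrite eB fm subset1 => /orP[/eqP->//|/eqP B0].
  move: eB; rewrite B0 f0 -{2}(flip0 p) => /flip_inj.
  by move=> /(_ j1 (sub0set _))/eqP; rewrite -cards_eq0 cards1.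
have [i iP] := choice atom.
pose A := [set i s | s in S]; exists A.
  by apply/subsetP => _ /imsetP[s _ ->]; case: (iP s).
have As : A \subset site p.
  by apply/subsetP => _ /imsetP[s _ ->]; case: (iP s).
have Aq : (flip p A <= q)%O.
  rewrite le_eta; apply/forallP => j; rewrite eta_flip//.
  case: imsetP => [[s _ ->]|_]; last first.
    by rewrite addn0; move: j; apply/forallP; rewrite -le_eta.
  have /andP[_] := fpq [set s]; rewrite le_eta => /forallP/(_ (i s)).
  have [sis e] := iP s; by rewrite e eta_flip ?sub1set// inE eqxx addn1.
have [B eB] : exists B, flip p A = f B by apply: segP; rewrite le_flip.
rewrite -fT eB; congr f; apply/eqP; rewrite eq_sym -subTset.
apply/subsetP => s _; rewrite -sub1set -fm -eB.
have [sis ->] := iP s; rewrite flip_le ?sub1set//.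
by rewrite imset_f.
Qed.

Lemma height_segment_flip p (A : {set 'I_N}) : A \subset site p ->
  height (segment p (flip p A)) = #|A|.
Proof.
move=> As; apply/eqP; rewrite eqn_leq; apply/andP; split.
  apply/bigmax_leqP => C /maxsetp/andP[/forall_inP chC /subsetP CI].
  have CB r : r \in C -> exists2 B : {set 'I_N}, B \subset A & r = flip p B.
    by move=> /CI/(segment_flipP _ As).
  pose up r := [set j | eta p j < eta r j].
  have upE (B : {set 'I_N}) : B \subset A -> up (flip p B) = B.
    move=> BA; apply/setP => j; rewrite inE eta_flip ?(subset_trans BA)//.
    by case: (j \in B); lia.
  have le_up (B : {set 'I_N}) : B \subset A -> #|B| < #|A|.+1.
    by move=> /subset_leq_card.
  rewrite -subn1 leq_subLR add1n -[X in _ <= X]card_ord.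
  (* Members of a chain in the segment are flips of nested subsets of [A], so the cardinality of
     [up r] tells them apart and takes at most [#|A|.+1] values. *)
  pose g r : 'I_(#|A|.+1) := inord #|up r|.
  rewrite -(@card_in_imset _ _ g C) ?max_card// => r s rC sC.
  have /forall_inP/(_ s sC) := chC r rC.
  have [B BA ->] := CB r rC; have [B' BA' ->] := CB s sC.
  have [Bs Bs'] := (subset_trans BA As, subset_trans BA' As).
  move=> cmp /(congr1 val); rewrite /= !inordK ?le_up ?upE// => e; congr flip.
  apply/eqP; move: cmp; rewrite /Order.comparable !flip_le//.
  case/orP => sub; [|rewrite eq_sym]; by rewrite eqEcard sub /= e.
(* Prefixes of an enumeration of [A] give a chain with [#|A|.+1] elements; a maximal chain
   containing it is long enough. *)
pose B (i : 'I_(#|A|.+1)) := [set j in take i (enum A)].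
have BA i : B i \subset A.
  by apply/subsetP => j; rewrite inE => /mem_take; rewrite mem_enum.
have Bs i := subset_trans (BA i) As.
have Bmono (i k : 'I_(#|A|.+1)) : i <= k -> B i \subset B k.
  move=> ik; apply/subsetP => j; rewrite !inE -(subnK ik).
  by rewrite addnC takeD mem_cat => ->.
have cardB i : #|B i| = i.
  rewrite cardsE (card_uniqP _) ?take_uniq ?enum_uniq// size_takel//.
  by rewrite -cardE -ltnS.
pose K := [set flip p (B i) | i : 'I_(#|A|.+1)].
have cardK : #|K| = #|A|.+1.
  rewrite card_imset ?card_ord// => i k /(flip_inj (Bs i) (Bs k)) e.
  by apply: val_inj; rewrite /= -(cardB i) e cardB.
have [|C maxC KC] := @maxset_exists _
    (fun K => is_chain K && (K \subset segment p (flip p A))) K.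
  apply/andP; split.
    apply/forall_inP => _ /imsetP[i _ ->]; apply/forall_inP => _ /imsetP[k _ ->].
    rewrite /Order.comparable !flip_le//.
    by case/orP: (leq_total i k) => /Bmono ->; rewrite ?orbT.
  by apply/subsetP => _ /imsetP[i _ ->]; apply/segment_flipP => //; exists (B i).
apply: (leq_trans _ (@leq_bigmax_cond _ _ (fun C : {set T} => #|C|.-1) C maxC)).
by have := subset_leq_card KC; rewrite cardK; case: #|C|.
Qed.

(** The map from (p, A) to [segment p (flip p A)] is a bijection from the pairs with
    [A \subset site p] onto the boolean intervals, and it turns [#|A|] into the height. *)
Lemma card_boolean_height k :
  #|[set I in boolean_intervals T | height I == k]| = \sum_p 'C(#|site p|, k).
Proof.
pose E := [set pA : T * {set 'I_N} | (pA.2 \subset site pA.1) && (#|pA.2| == k)].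
pose F (pA : T * {set 'I_N}) := segment pA.1 (flip pA.1 pA.2).
have -> : [set I in boolean_intervals T | height I == k] = F @: E.
  apply/setP => I; rewrite !inE; apply/andP/imsetP.
    move=> [/asboolP[[p [q [pq ->]]] bI]]; have [A As ->] := boolean_flip pq bI.
    rewrite height_segment_flip// => kA.
    by exists (p, A); rewrite ?inE ?As.
  move=> [[p A]]; rewrite inE /= => /andP[As /eqP Ak] ->.
  rewrite height_segment_flip// Ak; split=> //.
  apply/asboolP; split; last exact: segment_flip_boolean.
  by exists p, (flip p A); rewrite le_flip.
rewrite card_in_imset; last first.
  move=> [p A] [p' A']; rewrite !inE /= => /andP[As _] /andP[As' _].
  exact: segment_flip_inj.
rewrite -sum1dep_card -(pair_big_dep xpredT
  (fun p (A : {set 'I_N}) => (A \subset site p) && (#|A| == k)) (fun _ _ => 1)) /=.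
by apply: eq_bigr => p _; rewrite sum1dep_card cards_draws.
Qed.

End HeightBoolean.

(** * Paths as words *)

Section Words.
Local Open Scope nat_scope.

Definition ones (x : seq bool) (j : nat) : nat := count id (drop j x).

Lemma count_idN (s : seq bool) : count id s + count negb s = size s.
Proof. exact: count_predC. Qed.

(* Raising the suffix counts [ones x] at [j] alone moves the letter [true] of
   [j.-1] to [j], or sets the letter 0 to [true].  The default [true] excludes
   positions beyond the end of [x]. *)
Definition wsite (x : seq bool) (j : nat) : bool :=
  ~~ nth true x j && ((j == 0) || nth false x j.-1).

(** All moves at once. On sites the two tests never conflict: a site at [i] requires the letter [i]
    to be [false], a site at [i.+1] requires it to be [true]. *)
Definition wflip (x : seq bool) (A : nat -> bool) : seq bool :=
  mkseq (fun i => if A i then true else if A i.+1 then false else nth false x i)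
    (size x).

Lemma onesS (x : seq bool) j : j < size x ->
  ones x j = nth false x j + ones x j.+1.
Proof. by move=> jx; rewrite /ones (drop_nth false). Qed.

Lemma wsite_size x j : wsite x j -> j < size x.
Proof. by rewrite /wsite; case: ltnP => // xj; rewrite nth_default. Qed.

Lemma ones_wflip (x : seq bool) (A : nat -> bool) :
  (forall j, A j -> wsite x j) ->
  forall j, ones (wflip x A) j = ones x j + A j.
Proof.
move=> As j; have [xj|jx] := leqP (size x) j.
  rewrite /ones !drop_oversize ?size_mkseq//=.
  by case: (boolP (A j)) => // /As/wsite_size; rewrite ltnNge xj.
(* Descending induction on [j], from the end of the word. *)
rewrite -(subKn (ltnW jx)); move: (leq_subr j (size x)).
elim: (size x - j) => [_|i IH ix].
  rewrite subn0 /ones !drop_oversize ?size_mkseq//=.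
  by case: (boolP (A _)) => // /As/wsite_size; rewrite ltnn.
have e : (size x - i.+1).+1 = size x - i by rewrite subnSK.
have kx : size x - i.+1 < size x by lia.
rewrite (onesS kx) onesS ?size_mkseq// nth_mkseq// e IH ?(ltnW ix)// -e.
move: (size x - i.+1) kx => k kx.
have := As k; have := As k.+1; rewrite /wsite (@set_nth_default _ x false true k kx) /=.
move=> h1 h0; case: (A k.+1) h1 => [/(_ isT)/andP[_]|_]; case: (A k) h0 => [/(_ isT)/andP[]|_].
- by move=> /negbTE-> _.
- by rewrite addn0 addn1 => ->.
- by rewrite addn0 addn1 => /negbTE-> _.
- by rewrite !addn0.
Qed.


(** The leftmost [j] with letter [false] and a strict inequality works: were letter [j.-1] also
    [false], the inequality would be strict there too, against minimality. Such a [j] exists, for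
    otherwise an induction from the end gives [ones y <= ones x] everywhere. *)
Lemma wsite_lt (x y : seq bool) : size x = size y ->
  (forall j, ones x j <= ones y j) -> (exists j, ones x j < ones y j) ->
  exists2 j, wsite x j & ones x j < ones y j.
Proof.
move=> sxy le_xy [j0 j0lt].
have szlt j : ones x j < ones y j -> j < size x.
  by move=> lt; rewrite ltnNge; apply/negP => ?; rewrite {2}/ones drop_oversize -?sxy in lt.
pose Q j := ~~ nth true x j && (ones x j < ones y j).
have exQ : exists j, Q j.
  apply: contrapT => /forallNP nQ.
  have nx j : ones x j < ones y j -> nth false x j.
    move=> lt; apply: contrapT => /negP xj; apply: (nQ j).
    by rewrite /Q lt (@set_nth_default _ x false true) ?szlt// xj.
  suff : forall i, i <= size x -> ones y (size x - i) <= ones x (size x - i).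
    move=> /(_ (size x - j0) (leq_subr _ _)); rewrite subKn ?(ltnW (szlt _ j0lt))//.
    by rewrite leqNgt j0lt.
  elim=> [_|i IH ix]; first by rewrite subn0 {1}/ones drop_oversize// sxy.
  rewrite leqNgt; apply/negP => lt; have jx := szlt _ lt.
  have := nx _ lt; move: lt; rewrite (onesS jx) (@onesS y) -?sxy// => lt xi.
  move: lt (IH (ltnW ix)); rewrite xi subnSK//.
  by case: (nth false y _) => /= ? ?; lia.
case: (ex_minnP exQ) => j /andP[xj lt] jmin; exists j => //.
rewrite /wsite xj /=; case: j => // j in xj lt jmin *; rewrite /=.
apply: contrapT => /negP xj1.
have jx : j < size x by apply: ltnW; exact: szlt lt.
suff /jmin : Q j by rewrite ltnn.
rewrite /Q (@set_nth_default _ x false true)// xj1.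
by rewrite (onesS jx) (@onesS y) -?sxy// (negbTE xj1) add0n (leq_trans lt)// leq_addl.
Qed.

(* U^c D followed by one block per letter of [x]: D for [true], UD for [false]. *)
Fixpoint spath (c : nat) (x : seq bool) : seq bool :=
  nseq c true ++ false :: (if x is b :: x' then spath (~~ b) x' else [::]).

Lemma count_spath c x : count id (spath c x) = c + count negb x.
Proof.
by elim: x c => [|b x IH] c /=; rewrite count_cat count_nseq mul1n//= IH.
Qed.

Lemma countN_spath c x : count negb (spath c x) = (size x).+1.
Proof.
by elim: x c => [|b x IH] c /=; rewrite count_cat count_nseq mul0n//= IH.
Qed.

Lemma size_spath c x : size (spath c x) = c + count negb x + (size x).+1.
Proof.
by rewrite -count_spath -(countN_spath c) -count_idN.
Qed.

Lemma spath_cons c x : spath c.+1 x = true :: spath c x.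
Proof. by case: x. Qed.

Lemma spath_avoids c x : ~~ infix [:: false; true; true] (spath c x).
Proof.
elim: x c => [|b x IH]; elim=> [|c ihc] //.
rewrite [spath _ _]/= infix_consl negb_or IH andbT.
by case: b => //=; case: x {IH}.
Qed.

(** Induction on the word: a U in front lengthens the initial run, and a D in front is followed by a
    run of at most one U, which decides the new first letter. *)
Lemma spath_surj w : last true w = false ->
  ~~ infix [:: false; true; true] w -> exists c x, w = spath c x.
Proof.
elim: w => [//|a [|b w] IH]; first by case: a => // _ _; exists 0, [::].
move=> lw; rewrite infix_consl negb_or => /andP[pw iw].
have [c [x e]] := IH lw iw.
case: a pw lw => pw _; first by exists c.+1, x; rewrite e spath_cons.
exists 0, ((c == 0) :: x); rewrite e /=; case: c e => // -[//|c] e.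
by move: pw; rewrite e !spath_cons /= prefix0s.
Qed.

(** For [j <= size x], [c + count negb (take j x)] is the number of U before the D of index [j],
    counted from 0. Comparing the number of D in a prefix with [j] thus bounds its number of U, from
    above here and from below in [spath_ge]; [spath_take] gives the prefix ending just before that
    D. *)
Lemma spath_le c x i j : count negb (take i (spath c x)) <= j ->
  count id (take i (spath c x)) <= c + count negb (take j x).
Proof.
elim: i c x j => [|i IH] c x j; first by rewrite take0.
case: c => [|c]; last by rewrite spath_cons /= !addSn !add0n ltnS; exact: IH.
by case: x => [|b x] //=; case: j => [|j]//=; rewrite add1n ltnS !add0n; exact: IH.
Qed.

Lemma spath_ge c x i j : j < count negb (take i (spath c x)) ->
  c + count negb (take j x) <= count id (take i (spath c x)).
Proof.
elim: i c x j => [|i IH] c x j; first by rewrite take0.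
case: c => [|c]; last by rewrite spath_cons /= !addSn !add0n ltnS; exact: IH.
by case: x => [|b x] //=; case: j => [|j]//=; rewrite add1n ltnS !add0n; exact: IH.
Qed.

Lemma spath_take c x j : j <= size x ->
  let s := take (j + (c + count negb (take j x))) (spath c x) in
  count negb s = j /\ count id s = c + count negb (take j x).
Proof.
elim: j c x => [|j IH] c x jx /=.
  rewrite take0 /= addn0 add0n; elim: c => [|c [h1 h2]]; first by rewrite take0.
  by rewrite spath_cons /= h1 h2.
case: x jx => // b x jx; elim: c => [|c [h1 h2]].
  by have [h1 h2] := IH (~~ b) x jx; rewrite /= h1 h2.
by rewrite spath_cons addSn addnS /= h1 h2.
Qed.


End Words.

(** * The Stanley order in terms of suffix counts *)

Section PathsOfWords.
Local Open Scope nat_scope.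
Variable N : nat.
Implicit Types x y : N.-tuple bool.

(** The length of the initial run is the one that brings the path back to the axis. *)
Definition wpath (x : seq bool) : seq bool := spath (count id x).+1 x.

Lemma ordinateE (w : seq bool) i :
  ordinate w i = ((count id (take i w))%:Z - (count negb (take i w))%:Z)%R.
Proof.
rewrite /ordinate; elim: (take i w) => [|b s IH]; first by rewrite big_nil.
by rewrite big_cons IH; case: b => /=; lia.
Qed.

(** The left side counts the U before the D of index [j] in [wpath x]; as [j] steps D precede it,
    that D ends at ordinate [ones x j]. *)
Lemma zeros_take x j : j <= N ->
  (count id x).+1 + count negb (take j x) = (ones x j + j).+1.
Proof.
move=> jN; rewrite /ones -{1}(cat_take_drop j x) count_cat.
by have := count_idN (take j x); rewrite size_takel ?size_tuple//; lia.
Qed.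

Lemma size_wpath x : size (wpath x) == N.+1.*2.
Proof.
rewrite size_spath size_tuple; by have := count_idN x; rewrite size_tuple; lia.
Qed.

Lemma countN_take_wpath x i : count negb (take i (wpath x)) <= N.+1.
Proof.
rewrite -[N in N.+1](size_tuple x) -(countN_spath (count id x).+1).
by rewrite -[X in _ <= count _ X](cat_take_drop i) count_cat leq_addr.
Qed.

Lemma wpath_dyck x : is_dyck (Tuple (size_wpath x)).
Proof.
apply/andP; split; last first.
  rewrite /= ordinateE take_oversize ?(eqP (size_wpath x))//.
  rewrite count_spath countN_spath size_tuple.
  by have := @zeros_take x N (leqnn _); rewrite /ones take_oversize ?size_tuple//
    drop_oversize ?size_tuple//= => ->; rewrite subrr.
apply/forallP => i; rewrite /= ordinateE subr_ge0 lez_nat.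
have := countN_take_wpath x i.
case e : (count negb _) => [//|k] kN.
apply: (leq_trans _ (@spath_ge _ _ _ k _)); last by rewrite -/(wpath x) e.
by rewrite zeros_take// ltnS leq_addl.
Qed.

Definition wdyck x : dyck N.+1 := 
  exist (fun w : (N.+1.*2).-tuple bool => is_true (is_dyck w)) _ (wpath_dyck x).

Lemma wpath_avoids x : avoids [:: false; true; true] (wdyck x).
Proof. exact: spath_avoids. Qed.

Definition wFinf x : Finf N.+1 := 
  exist (fun p : dyck N.+1 => is_true (avoids [:: false; true; true] p)) _ (wpath_avoids x).

Lemma wFinf_le x y :
  (wFinf x <= wFinf y)%O = [forall j : 'I_N, ones x j <= ones y j].
Proof.
have sz (z : N.-tuple bool) i : i <= N.+1.*2 ->
    count id (take i (wpath z)) + count negb (take i (wpath z)) = i.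
  by move=> iN; rewrite count_idN size_takel ?(eqP (size_wpath z)).
apply/forallP/forallP => /= [h j|h i].
  have jN : j <= N by exact: ltnW.
  have [|hd hu] := @spath_take (count id x).+1 x j; first by rewrite size_tuple.
  (* The abscissa just before the D of index [j] in the path of [x]. There the path of [y] is at
     least as high, so it has made at most [j] steps D, and [spath_le] bounds its number of U by
     [ones y j + j + 1]. *)
  set i := j + _ in hd hu.
  have iN : i < N.+1.*2.+1.
    rewrite ltnS -(eqP (size_wpath x)) size_spath size_tuple /i.
    have : count negb (take j x) <= count negb x.
      by rewrite -{2}(cat_take_drop j x) count_cat leq_addr.
    by lia.
  have := h (Ordinal iN); rewrite /= !ordinateE.
  have := sz y i iN; have := sz x i iN; have := @spath_le (count id y).+1 y i j.
  rewrite -/(wpath x) -/(wpath y) hd hu !zeros_take//.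
  by lia.
(* Were the path of [y] lower at [i], it would have made more than k steps D, k being the number
   made by [x]; [spath_ge] for [y] and [spath_le] for [x] would then contradict
   [ones x k <= ones y k]. *)
rewrite /= !ordinateE.
have := sz x i (ltn_ord i); have := sz y i (ltn_ord i).
have := @spath_le (count id x).+1 x i _ (leqnn _).
have := @spath_ge (count id y).+1 y i (count negb (take i (wpath x))).
rewrite -!/(wpath _).
have := countN_take_wpath y i; have := countN_take_wpath x i.
move: (count negb (take i (wpath x))) => k kN.
have [kN'|kN'] := leqP k N; last by lia.
have : ones x k <= ones y k.
  have [kN2|kN2] := ltnP k N; first exact: (h (Ordinal kN2)).
  by rewrite /ones !drop_oversize ?size_tuple.
by rewrite !zeros_take//; lia.
Qed.

Lemma ones_inj x y : (forall j, ones x j = ones y j) -> x = y.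
Proof.
move=> e; apply/val_inj/(@eq_from_nth _ false); rewrite ?size_tuple// => i iN.
have := e i; rewrite (@onesS x i) ?(@onesS y i) ?size_tuple// e.
by case: (nth _ x i); case: (nth _ y i) => //; lia.
Qed.

Lemma wFinf_inj : injective wFinf.
Proof.
move=> x y e; apply: ones_inj => j.
have [jN|jN] := ltnP j N; last by rewrite /ones !drop_oversize ?size_tuple.
apply/eqP; rewrite eqn_leq.
have := wFinf_le x y; have := wFinf_le y x; rewrite e lexx.
by move=> /esym/forallP/(_ (Ordinal jN))/= -> /esym/forallP/(_ (Ordinal jN))/= ->.
Qed.

Lemma wFinf_surj (p : Finf N.+1) : exists x, wFinf x = p.
Proof.
case: p => -[w wd] wav; have /andP[/forallP w_ge /eqP w0] := wd.
have {w0} : ordinate w N.+1.*2 = 0%R by [].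
rewrite ordinateE take_oversize ?size_tuple// => w0.
have sw := count_idN w; rewrite size_tuple in sw.
(* A final U would have to start at ordinate -1. *)
have lw : last true w = false.
  case/lastP: (tval w) (size_tuple w) w_ge w0 => [//|s b sz w_ge w0].
  rewrite last_rcons; case: b w_ge w0 sz => // w_ge w0 sz.
  have hs : size s < N.+1.*2.+1 by rewrite -sz size_rcons; lia.
  have /= := w_ge (Ordinal hs).
  move: w0; rewrite ordinateE -cats1 !count_cat take_size_cat//=; lia.
have [c [x wE]] := spath_surj lw wav.
have sx : size x = N.
  have := countN_spath c x; rewrite -wE; lia.
have cE : c = (count id x).+1.
  have := count_spath c x; have := countN_spath c x; rewrite -wE.
  by have := count_idN x; lia.
have sxb : size x == N by rewrite sx.
exists (Tuple sxb); do 3 apply: val_inj; rewrite /= wE cE.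
by [].
Qed.

Lemma sum_boolean_height k :
  #|[set I in boolean_intervals (Finf N.+1) | height I == k]| =
  \sum_(x : N.-tuple bool) 'C(count (wsite x) (iota 0 N), k).
Proof.
have [g gK] := choice wFinf_surj.
have gK' x : g (wFinf x) = x by apply: wFinf_inj; rewrite gK.
(* [wflip] keeps the length, so [insubd] never returns its default value [g p]. *)
pose flip (p : Finf N.+1) (A : {set 'I_N}) : Finf N.+1 :=
  wFinf (insubd (g p) (wflip (g p) (fun i => [exists j in A, i == j :> nat]))).
rewrite (@card_boolean_height _ _ N (fun p j => ones (g p) j)
  (fun p => [set j : 'I_N | wsite (g p) j]) flip).
- rewrite (reindex wFinf) /=; last first.
    by exists g => x _; rewrite ?gK ?gK'.
  apply: eq_bigr => x _; congr 'C(_, _); rewrite gK' cardsE cardE /enum_mem size_filter.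
  by rewrite -val_enum_ord count_map enumT; apply: eq_count.
- by move=> p q; rewrite -{1}(gK p) -{1}(gK q) wFinf_le.
- move=> p A /subsetP As j; rewrite /flip gK' val_insubd size_mkseq size_tuple eqxx.
  rewrite ones_wflip; last first.
    by move=> i /exists_inP[l lA /eqP ->]; have := As l lA; rewrite inE.
  congr (_ + nat_of_bool _); apply/exists_inP/idP => [[i iA /eqP/val_inj->//]|jA].
  by exists j.
- move=> p q pq; have : (p <= q)%O by exact: ltW.
  rewrite -{1}(gK p) -{1}(gK q) wFinf_le => /forallP le_pq.
  have le j : ones (g p) j <= ones (g q) j.
    have [jN|jN] := ltnP j N; first exact: (le_pq (Ordinal jN)).
    by rewrite /ones !drop_oversize ?size_tuple.
  have [||j sj lt] := @wsite_lt (g p) (g q) _ le; rewrite ?size_tuple//.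
    apply: contrapT => /forallNP h; move: pq; rewrite -(gK p) -(gK q).
    have -> : g p = g q; last by rewrite ltxx.
    apply: ones_inj => j; apply/eqP; rewrite eqn_leq le leqNgt.
    by apply/negP/h.
  have jN : j < N by have := wsite_size sj; rewrite size_tuple.
  by exists (Ordinal jN); rewrite ?inE.
Qed.

End PathsOfWords.

(** * Counting boolean intervals by height *)

Section Counting.
Local Open Scope nat_scope.

(* [nsite b x] counts the sites of [x] when the letter before [x] is [b]. *)
Fixpoint nsite (b : bool) (x : seq bool) : nat :=
  if x is c :: x' then (b && ~~ c) + nsite c x' else 0.

(** A [false] at position 0 is a site, exactly as if [true] preceded the word. *)
Lemma count_wsite x : count (wsite x) (iota 0 (size x)) = nsite true x.
Proof.
suff nsiteE b : count (fun j => ~~ nth true x j && nth false (b :: x) j)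
    (iota 0 (size x)) = nsite b x.
  by rewrite -nsiteE; apply: eq_count => -[|j]; rewrite /wsite.
elim: x b => [//|c x IH] b.
rewrite [size _]/= [iota _ _]/= [count _ _]/= -[1]addn0 iotaDl count_map.
by rewrite -[nsite b _]/((b && ~~ c) + nsite c x) -IH andbC; congr (_ + _).
Qed.

(** Number of pairs formed by a word of length [N] and [k] of its sites, so that [siteW true N k]
    counts the boolean intervals of height [k] in semilength [N.+1]. *)
Definition siteW (b : bool) (N k : nat) : nat :=
  \sum_(x : N.-tuple bool) 'C(nsite b x, k).

Lemma sum_tupleS (N : nat) (F : seq bool -> nat) :
  \sum_(x : N.+1.-tuple bool) F x =
  \sum_(x : N.-tuple bool) F (true :: x) + \sum_(x : N.-tuple bool) F (false :: x).
Proof.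
rewrite -(@big_bool _ _ addn (fun b => \sum_(x : N.-tuple bool) F (b :: x))).
rewrite pair_big /=.
rewrite (reindex (fun p : bool * N.-tuple bool => [tuple of p.1 :: p.2])) //=.
exists (fun x => (thead x, [tuple of behead x])) => [[b x] _|x _] /=.
  by congr pair; apply: val_inj.
by rewrite -tuple_eta.
Qed.

Lemma siteW0 b k : siteW b 0 k = (k == 0).
Proof.
rewrite /siteW (big_pred1 [tuple]) => [|x]; last first.
  by apply/esym/eqP/val_inj; case: x => -[].
by rewrite bin0n.
Qed.

Lemma siteW_false N k : siteW false N.+1 k = siteW true N k + siteW false N k.
Proof. by rewrite /siteW (sum_tupleS _ (fun x => 'C(nsite false x, k))). Qed.

Lemma siteW_true0 N : siteW true N 0 = siteW false N 0.
Proof. by apply: eq_bigr => x _; rewrite !bin0. Qed.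

(** A first letter [false] is one more site, and Pascal's rule splits the choices according to
    whether it is picked. *)
Lemma siteW_trueS N k :
  siteW true N.+1 k.+1 = siteW false N.+1 k.+1 + siteW false N k.
Proof.
rewrite siteW_false {1}/siteW (sum_tupleS _ (fun x => 'C(nsite true x, k.+1))) /=.
by under [X in _ + X = _]eq_bigr do rewrite add1n binS; rewrite big_split addnA.
Qed.

(** Picking k sites amounts to placing k disjoint factors [true], [false] and filling the other N -
    2k letters freely. The induction uses the recurrence F(N + 2, k + 1) = 2 F(N + 1, k + 1) + F(N,
    k). *)
Lemma siteW_falseE N k : siteW false N k = 'C(N - k, k) * 2 ^ (N - k.*2).
Proof.
elim/ltn_ind: N k => -[|N] IH k.
  by rewrite siteW0 sub0n muln1 bin0n.
rewrite siteW_false; case: k => [|k].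
  by rewrite siteW_true0 IH// !subn0 !bin0 !mul1n expnS mul2n addnn.
case: N IH => [|N] IH; first by rewrite !siteW0 subSS sub0n bin0n.
rewrite siteW_trueS !IH// addnAC addnn -(mul2n ('C(_, _) * _)) doubleS !subSS.
have [kN|kN] := leqP k.*2 N; last first.
  by rewrite !bin_small ?muln0//; lia.
rewrite subSn; last lia.
rewrite binS mulnDl; congr (_ + _).
have [e|lt] := eqVneq k.*2 N; first by rewrite bin_small//; lia.
rewrite mulnCA; congr (_ * _); rewrite -expnS; congr expn; lia.
Qed.

(** Distinct sites occupy disjoint pairs of letters, the letter supposed before the word included,
    so k sites need 2k <= N + 1. *)
Lemma siteW_small N k : N.+1 < k.*2 -> siteW true N k = 0.
Proof.
case: N k => [|N] [|k]; rewrite ?siteW0// => Nk.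
rewrite siteW_trueS !siteW_falseE !bin_small//; lia.
Qed.

Lemma siteW_trueE N k : k.*2 <= N.+1 ->
  2 * (N.+1 - k) * siteW true N k = N.+1 * 'C(N.+1 - k, k) * 2 ^ (N.+1 - k.*2).
Proof.
case: k => [|k] kN.
  rewrite siteW_true0 siteW_falseE !subn0 !bin0 mul1n muln1 expnS; lia.
case: N kN => [//|N] kN.
rewrite siteW_trueS !siteW_falseE.
have [M NE] : exists M, N = M + k by exists (N - k); lia.
have kM : k <= M by lia.
have -> : N.+1 - k.+1 = M by lia.
have -> : N - k = M by lia.
have -> : N.+2 - k.+1 = M.+1 by lia.
have -> : N.+2 - k.+1.*2 = M - k by lia.
have -> : N - k.*2 = M - k by lia.
have -> : 2 * M.+1 * ('C(M, k.+1) * 2 ^ (N.+1 - k.+1.*2) + 'C(M, k) * 2 ^ (M - k)) =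
  M.+1 * ('C(M, k.+1) + 2 * 'C(M, k)) * 2 ^ (M - k).
  have [e|ltkM] := eqVneq k M; first by rewrite bin_small ?e//; lia.
  have -> : M - k = (N.+1 - k.+1.*2).+1 by lia.
  rewrite expnS; lia.
congr (_ * _).
(* Pascal's rule leaves ['C(M.+1, k.+1) + 'C(M, k)], and [M.+1 * 'C(M, k) = k.+1 * 'C(M.+1, k.+1)];
   the coefficients add up to M + k + 2 = N + 2. *)
rewrite mul2n -addnn addnA -binS mulnDr (mul_bin_diag M.+1 k) -mulnDl; congr (_ * _); lia.
Qed.

Lemma siteW_gt0 N k : k.*2 <= N.+1 -> 0 < siteW true N k.
Proof.
move=> kN; have := siteW_trueE kN; case: (siteW true N k) => // /esym/eqP.
rewrite muln0 !muln_eq0 /= expn_eq0 orbF -leqn0 leqNgt bin_gt0; lia.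
Qed.

Lemma siteW_ratio N k : k.*2 <= N.+1 ->
  4 * k.+1 * (N.+1 - k.+1) * siteW true N k.+1 =
  (N.+1 - k.*2) * (N.+1 - k.*2.+1) * siteW true N k.
Proof.
(* When 2(k + 1) exceeds N + 1 both sides vanish, the right one through truncated subtraction;
   otherwise the closed forms at k and k + 1 are compared. *)
move=> kN; have [kN2|kN2] := leqP k.+1.*2 N.+1; last first.
  have -> : N.+1 - k.*2.+1 = 0 by lia.
  by rewrite muln0 mul0n siteW_small// muln0.
have h1 := siteW_trueE kN; have h2 := siteW_trueE kN2.
apply/eqP; rewrite -(@eqn_pmul2l (N.+1 - k)); last lia.
have [M NE] : exists M, N.+1 = (M + k).+1 by exists (N - k); lia.
move: h1 h2; have -> : N.+1 - k = M.+1 by lia.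
have -> : N.+1 - k.+1 = M by lia.
have -> : N.+1 - k.*2 = (M - k).+1 by lia.
have -> : N.+1 - k.*2.+1 = M - k by lia.
have -> : N.+1 - k.+1.*2 = (M - k).-1 by lia.
move=> h1 h2; have hb1 := mul_bin_down M.+1 k; have hb2 := mul_bin_left M k.
have e : 2 ^ (M - k).+1 = 4 * 2 ^ (M - k).-1.
  have {1}-> : M - k = (M - k).-1.+1 by lia.
  by rewrite !expnS; lia.
rewrite e in h1; rewrite subSn in hb1; last lia.
move: h1 h2 hb1 hb2; rewrite [M.+1.-1]/=; move: (2 ^ _) => p.
move: (M - k) => d; move: (siteW true N k.+1) (siteW true N k) (N.+1) => a' a n.
move: 'C(M.+1, k) 'C(M, k.+1) 'C(M, k) => c1 c2 c3 h1 h2 hb1 hb2.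
have -> : M.+1 * (4 * k.+1 * M * a') = 2 * M.+1 * k.+1 * (2 * M * a') by lia.
rewrite h2; have -> : M.+1 * (d.+1 * d * a) = d.+1 * d * (M.+1 * a) by lia.
have {h1}-> : M.+1 * a = 2 * n * c1 * p by lia.
have -> : d.+1 * d * (2 * n * c1 * p) = 2 * n * d * p * (d.+1 * c1) by lia.
rewrite -hb1.
have -> : 2 * M.+1 * k.+1 * (n * c2 * p) = 2 * M.+1 * n * p * (k.+1 * c2) by lia.
by rewrite hb2; apply/eqP; lia.
Qed.


End Counting.

(** * Gaussian estimates for the counting sequence *)

(* Imported only now: the names of classical sets shadow those of finite sets. *)
From mathcomp Require Import all_classical all_reals all_analysis measurable_realfun.
From mathcomp Require Import zify ring lra.
Import Order.TTheory GRing.Theory Num.Theory.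
Import numFieldNormedType.Exports.
Local Open Scope ring_scope.

(** * Bounds on the ratio of consecutive counts *)

Section RatioBounds.
Context {R : realType}.
Local Notation q := (Num.sqrt 2 : R).

Lemma sqrt2_sqr : q ^+ 2 = 2.
Proof. by rewrite sqr_sqrtr. Qed.

Lemma sqrt2_gt : 7 / 5 < q.
Proof.
rewrite -(@ltr_pXn2r _ 2) ?nnegrE ?sqrtr_ge0 ?sqrt2_sqr//; lra.
Qed.

Lemma sqrt2_lt : q < 3 / 2.
Proof.
rewrite -(@ltr_pXn2r _ 2) ?nnegrE ?sqrtr_ge0 ?sqrt2_sqr//; lra.
Qed.

(* With k = mu n + y, where mu = (2 - sqrt 2) / 4, these are (n - 2k)(n - 2k - 1)
   and 4 (k + 1) (n - k - 1). *)
Definition rnum (n y : R) : R := (n * q / 2 - 2 * y) * (n * q / 2 - 2 * y - 1).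
Definition rden (n y : R) : R := n ^+ 2 - (n * q / 2 - 2 * (y + 1)) ^+ 2.

(** The terms in n^2 cancel because [q ^+ 2 = 2], which reflects the choice of mu. *)
Lemma rnumB n y : rnum n y - rden n y =
  - (8 * y + 5) * (n * q / 2) + 8 * y ^+ 2 + 10 * y + 4.
Proof.
rewrite /rnum /rden.
have -> : (n * q / 2 - 2 * y) * (n * q / 2 - 2 * y - 1) -
   (n ^+ 2 - (n * q / 2 - 2 * (y + 1)) ^+ 2) =
   - (8 * y + 5) * (n * q / 2) + 8 * y ^+ 2 + 10 * y + 4 + n ^+ 2 * (q ^+ 2 - 2) / 2.
  by field.
by rewrite sqrt2_sqr subrr mulr0 mul0r addr0.
Qed.

Section Local.
(** [L] bounds the square of the rescaled deviation y / sqrt n, and [400 * L <= n] then gives |y| <=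
    n / 20. *)
Variables (n y L : R).
Hypotheses (L1 : 1 <= L) (nL : 400 * L <= n) (yL : y ^+ 2 <= L * n).

Let n_gt : 400 <= n. Proof. by move: L1 nL => h1 h2; lra. Qed.

Let y_small : `|y| <= n / 20.
Proof.
move: L1 nL yL n_gt => L1' nL' yL' h3.
have n0 : 0 <= n / 20 by lra.
have hLn : L * n <= (n / 20) ^+ 2.
  have -> : (n / 20) ^+ 2 = n / 400 * n by field.
  by rewrite ler_wpM2r//; lra.
by rewrite -ler_sqr ?nnegrE ?real_normK ?num_real// (le_trans yL').
Qed.

Lemma rden_local : n ^+ 2 / 4 <= rden n y.
Proof.
move: L1 nL yL => L1' nL' yL'.
have := y_small; rewrite ler_norml => /andP[y1 y2].
have h1 := sqrt2_gt; have h2 := sqrt2_lt; have h3 := n_gt.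
have a0 : 0 <= n * q / 2 - 2 * (y + 1) by nra.
have a1 : n * q / 2 - 2 * (y + 1) <= 17 / 20 * n by nra.
rewrite /rden; nra.
Qed.

Lemma rnum_local : n ^+ 2 / 4 <= rnum n y.
Proof.
move: L1 nL yL => L1' nL' yL'.
have := y_small; rewrite ler_norml => /andP[y1 y2].
have h1 := sqrt2_gt; have h2 := sqrt2_lt; have h3 := n_gt.
have a0 : n / 2 <= n * q / 2 - 2 * y - 1 by nra.
have a1 : n / 2 <= n * q / 2 - 2 * y by nra.
rewrite /rnum; nra.
Qed.

(** [4 * q * (2 * y + 1)] is the growth of 4 q y^2 from y to y + 1. As [rden n y] is about n^2 / 2,
    it cancels the leading part - 4 q y n^2 of [n * (rnum n y - rden n y)], which leaves terms of
    order L n^2. *)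
Lemma ratio_excess :
  n * (rnum n y - rden n y) + (4 * q) * (2 * y + 1) * rden n y =
  - q / 2 * n ^+ 2 + n * (40 * y ^+ 2 + 58 * y + 20)
  - 16 * (q * (2 * y + 1) * (y + 1) ^+ 2).
Proof.
move: L1 nL yL => L1' nL' yL'.
rewrite rnumB /rden; have := sqrt2_sqr; move: q => p p2.
have -> : n * (- (8 * y + 5) * (n * p / 2) + 8 * y ^+ 2 + 10 * y + 4) +
  4 * p * (2 * y + 1) * (n ^+ 2 - (n * p / 2 - 2 * (y + 1)) ^+ 2) =
  - p / 2 * n ^+ 2 + n * (40 * y ^+ 2 + 58 * y + 20)
  - 16 * (p * (2 * y + 1) * (y + 1) ^+ 2) -
  (p ^+ 2 - 2) * ((2 * y + 1) * p * n ^+ 2 - 8 * (2 * y + 1) * n * (y + 1)) by field.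
by rewrite p2 subrr mul0r subr0.
Qed.

Let cubic_small : `|q * (2 * y + 1) * (y + 1) ^+ 2| <= L * n ^+ 2.
Proof.
move: L1 nL yL => L1' nL' yL'.
have := y_small; rewrite ler_norml => /andP[y1 y2].
have h1 := sqrt2_gt; have h2 := sqrt2_lt; have h3 := n_gt.
rewrite 2!normrM (ger0_norm (sqrtr_ge0 _)) (ger0_norm (sqr_ge0 _)).
have b1 : `|2 * y + 1| <= n / 5 by rewrite ler_norml; apply/andP; split; lra.
have b2 : (y + 1) ^+ 2 <= 3 * L * n by nra.
have b3 : q * `|2 * y + 1| <= 3 / 2 * (n / 5).
  by apply: ler_pM => //; lra.
have : q * `|2 * y + 1| * (y + 1) ^+ 2 <= 3 / 2 * (n / 5) * (3 * L * n).
  exact: ler_pM (mulr_ge0 (sqrtr_ge0 _) (normr_ge0 _)) (sqr_ge0 _) b3 b2.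
have : 0 <= L * n ^+ 2 by nra.
lra.
Qed.

Let yyn : n * y ^+ 2 <= L * n ^+ 2.
Proof.
move: yL n_gt => yL' h3; have n0 : 0 <= n by lra.
by have -> : L * n ^+ 2 = n * (L * n); [ring | rewrite ler_wpM2l].
Qed.

Let nnL : n ^+ 2 <= L * n ^+ 2. Proof. by move: L1 n_gt => L1' h; nra. Qed.

Let quad_ub : n * (40 * y ^+ 2 + 58 * y + 20) <= 120 * (L * n ^+ 2).
Proof.
move: L1 nL yL => L1' nL' yL'.
have h3 := n_gt.
have a : 40 * y ^+ 2 + 58 * y + 20 <= 69 * y ^+ 2 + 49 by have := sqr_ge0 (y - 1); lra.
have : n * (40 * y ^+ 2 + 58 * y + 20) <= n * (69 * y ^+ 2 + 49).
  by rewrite ler_pM2l//; lra.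
have : n <= n ^+ 2 by nra.
have := yyn; have := nnL; lra.
Qed.

Let quad_lb : - (2 * (L * n ^+ 2)) <= n * (40 * y ^+ 2 + 58 * y + 20).
Proof.
move: L1 nL yL => L1' nL' yL'.
have h3 := n_gt.
have a : - 2 <= 40 * y ^+ 2 + 58 * y + 20 by have := sqr_ge0 (40 * y + 29); lra.
have : n * - 2 <= n * (40 * y ^+ 2 + 58 * y + 20).
  by rewrite ler_pM2l//; lra.
have : n <= n ^+ 2 by nra.
have := yyn; have := nnL; lra.
Qed.

(** The right side of [ratio_excess] is at most 136 L n^2, while [rden_local] makes the bound at
    least 250 L n^2. *)
Lemma ratio_local_up :
  n * (rnum n y - rden n y) + 4 * q * (2 * y + 1) * rden n y
    <= 10 * (10 * (10 * L)) * rden n y.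
Proof.
move: L1 nL yL => L1' nL' yL'.
have hd := rden_local.
have : 10 * (10 * (10 * L)) * (n ^+ 2 / 4) <= 10 * (10 * (10 * L)) * rden n y.
  by rewrite ler_pM2l//; lra.
rewrite ratio_excess; move: cubic_small; rewrite ler_norml => /andP[c1 c2].
have := quad_ub; have := sqr_ge0 n; have := sqrt2_gt; have := nnL.
have : 0 <= q * n ^+ 2 by rewrite mulr_ge0 ?sqr_ge0 ?sqrtr_ge0.
lra.
Qed.

(** Multiplying the tilt by [rnum] instead of [rden] brings in 4 q (2 y + 1) (rnum - rden), again of
    order L n^2. *)
Lemma ratio_local_down :
  n * (rden n y - rnum n y) - 4 * q * (2 * y + 1) * rnum n y
    <= 10 * (10 * (10 * L)) * rnum n y.
Proof.
move: L1 nL yL => L1' nL' yL'.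
have hd := rnum_local.
have : 10 * (10 * (10 * L)) * (n ^+ 2 / 4) <= 10 * (10 * (10 * L)) * rnum n y.
  by rewrite ler_pM2l//; lra.
have -> : n * (rden n y - rnum n y) - 4 * q * (2 * y + 1) * rnum n y =
  - (n * (rnum n y - rden n y) + 4 * q * (2 * y + 1) * rden n y) -
  4 * q * (2 * y + 1) * (rnum n y - rden n y) by ring.
rewrite ratio_excess rnumB; move: cubic_small; rewrite ler_norml => /andP[c1 c2].
have -> : 4 * q * (2 * y + 1) * (- (8 * y + 5) * (n * q / 2) + 8 * y ^+ 2 + 10 * y + 4)
  = - (q ^+ 2 * n * (32 * y ^+ 2 + 36 * y + 10)) +
    32 * (q * (2 * y + 1) * (y + 1) ^+ 2) - q * (2 * y + 1) * (24 * y + 16).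
  by field.
rewrite sqrt2_sqr.
have : 2 * n * (32 * y ^+ 2 + 36 * y + 10) <= 156 * (L * n ^+ 2).
  have h3 := n_gt.
  have a : 32 * y ^+ 2 + 36 * y + 10 <= 50 * y ^+ 2 + 28 by have := sqr_ge0 (y - 1); lra.
  have : n * (32 * y ^+ 2 + 36 * y + 10) <= n * (50 * y ^+ 2 + 28).
    by rewrite ler_pM2l//; lra.
  have : n <= n ^+ 2 by nra.
  have := yyn; have := nnL; lra.
have : q * (2 * y + 1) * (24 * y + 16) <= L * n ^+ 2.
  have := y_small; rewrite ler_norml => /andP[y1 y2].
  have h1 := sqrt2_gt; have h2 := sqrt2_lt; have h3 := n_gt.
  have : (2 * y + 1) * (24 * y + 16) <= 2 * (n ^+ 2) / 3 by nra.
  have := nnL; nra.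
have := quad_lb; have := sqr_ge0 n; have := nnL.
have : q * n ^+ 2 <= 3 / 2 * n ^+ 2 by rewrite ler_wpM2r ?sqr_ge0// ltW ?sqrt2_lt.
lra.
Qed.

End Local.

Section Global.
Variables (n y : R).
Hypothesis n_gt : 10 <= n.

Lemma rden_global : -1 <= y -> y + 1 <= n * q / 4 -> n ^+ 2 / 4 <= rden n y.
Proof.
move: n_gt => n_gt'.
move=> y1 y2; have h1 := sqrt2_gt; have h2 := sqrt2_sqr.
have a0 : 0 <= n * q / 2 - 2 * (y + 1) by lra.
have a1 : n * q / 2 - 2 * (y + 1) <= n * q / 2 by lra.
have : (n * q / 2 - 2 * (y + 1)) ^+ 2 <= (n * q / 2) ^+ 2.
  by rewrite ler_pXn2r ?nnegrE//; lra.
have -> : (n * q / 2) ^+ 2 = n ^+ 2 * q ^+ 2 / 4 by field.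
by rewrite h2 /rden; have := sqr_ge0 n; lra.
Qed.

(** With z = y + 1, the square term takes at most half of the drift - 4 q z n^2, because z <= n q /
    4. The remaining - 2 q z n^2 absorbs the tilt, at most 2 z n^2, and what is left is O(n^2). *)
Lemma ratio_global_up : -1 <= y -> y + 1 <= n * q / 4 ->
  n * (rnum n y - rden n y) + (2 * y + 1) * rden n y <= 24 * rden n y.
Proof.
move: n_gt => n_gt'.
move=> y1 y2; have hd := rden_global y1 y2.
have h1 := sqrt2_gt; have h2 := sqrt2_lt.
have hu : rden n y <= n ^+ 2 by rewrite /rden lerBlDr lerDl sqr_ge0.
rewrite rnumB; move: (rden n y) hd hu => D hd hu; set z := y + 1.
have -> : y = z - 1 by rewrite /z; lra.
have z0 : 0 <= z by rewrite /z; lra.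
have zz : z ^+ 2 <= z * (n * q / 4) by rewrite expr2 ler_wpM2l.
have e1 : n * (- (8 * (z - 1) + 5) * (n * q / 2) + 8 * (z - 1) ^+ 2 + 10 * (z - 1) + 4)
  <= n * (- 2 * q * n * z + 3 * n * q / 2 + 2).
  by rewrite ler_pM2l; [nra|lra].
have e2 : 2 * z * D <= 2 * z * n ^+ 2 by rewrite ler_wpM2l//; lra.
have e3 : z * n ^+ 2 * q >= z * n ^+ 2 * (7 / 5).
  by apply: ler_wpM2l; [rewrite mulr_ge0 ?sqr_ge0 | exact: ltW].
have e4 : n ^+ 2 * q <= n ^+ 2 * (3 / 2) by apply: ler_wpM2l; [exact: sqr_ge0 | exact: ltW].
have e5 : n <= n ^+ 2 by nra.
have e6 : 0 <= z * n ^+ 2 by rewrite mulr_ge0 ?sqr_ge0.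
lra.
Qed.

Lemma rnum_global : y <= 0 -> n ^+ 2 / 4 <= rnum n y.
Proof.
move: n_gt => n_gt'.
move=> y1; have h1 := sqrt2_gt; have h2 := sqrt2_lt.
have a0 : n / 2 <= n * q / 2 - 2 * y - 1 by nra.
have a1 : n / 2 <= n * q / 2 - 2 * y by lra.
rewrite /rnum; nra.
Qed.

(** With z = - y the square term has the favourable sign, and the drift - 4 q z n^2 absorbs 2 z
    [rnum n y]. *)
Lemma ratio_global_down : - ((2 - q) / 4 * n) <= y -> y <= 0 ->
  n * (rden n y - rnum n y) - (2 * y + 1) * rnum n y <= 24 * rnum n y.
Proof.
move: n_gt => n_gt'.
move=> y1 y2; have hd := rnum_global y2.
have h1 := sqrt2_gt; have h2 := sqrt2_lt.
have hu : rnum n y <= n ^+ 2.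
  by rewrite expr2 /rnum ler_pM//; nra.
have -> : rden n y - rnum n y = - (rnum n y - rden n y) by rewrite opprB.
rewrite rnumB; move: (rnum n y) hd hu => D hd hu; set z := - y.
have -> : y = - z by rewrite /z; lra.
have z0 : 0 <= z by rewrite /z; lra.
have zn : z <= n / 5 by rewrite /z; nra.
have zz : z * n <= n ^+ 2 / 5 by nra.
have e2 : 2 * z * D <= 2 * z * n ^+ 2 by rewrite ler_wpM2l//; lra.
have e3 : z * n ^+ 2 * q >= z * n ^+ 2 * (7 / 5).
  by apply: ler_wpM2l; [rewrite mulr_ge0 ?sqr_ge0 | exact: ltW].
have e4 : n ^+ 2 * q <= n ^+ 2 * (3 / 2) by apply: ler_wpM2l; [exact: sqr_ge0 | exact: ltW].
have e6 : 0 <= z * n ^+ 2 by rewrite mulr_ge0 ?sqr_ge0.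
have e7 : 0 <= n * z ^+ 2 by rewrite mulr_ge0 ?sqr_ge0//; lra.
have -> : - (- (8 * - z + 5) * (n * q / 2) + 8 * (- z) ^+ 2 + 10 * - z + 4) =
  - (4 * q * n * z) + 5 / 2 * n * q - 8 * z ^+ 2 + 10 * z - 4 by field.
lra.
Qed.

End Global.

End RatioBounds.

(** Here x' = x (1 + (num - den) / den) and 1 + u <= exp u; the last hypothesis bounds (num - den) /
    den + d / n by c / n. *)
Lemma ratio_expR_step (R : realType) (x x' num den d c n : R) :
  0 <= x -> 0 < den -> 0 < n -> x' * den = x * num ->
  n * (num - den) + d * den <= c * den -> x' * expR (d / n) <= x * expR (c / n).
Proof.
move=> x0 den0 n0 e le.
have -> : x' = x * (1 + (num - den) / den).
  by rewrite -(mulfK (lt0r_neq0 den0) x') e; field; exact: lt0r_neq0.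
apply: (@le_trans _ _ (x * expR ((num - den) / den) * expR (d / n))).
  by rewrite ler_wpM2r ?expR_ge0// ler_wpM2l// expR_ge1Dx.
rewrite -mulrA -expRD ler_wpM2l// ler_expR.
have -> : (num - den) / den + d / n = (n * (num - den) + d * den) / den / n.
  by field; rewrite !lt0r_neq0.
by rewrite ler_wpM2r ?invr_ge0 ?(ltW n0)// ler_pdivrMr.
Qed.

Lemma chain_expR (R : realType) (g : nat -> R) (c : R) (i j : nat) : (i <= j)%N ->
  (forall k, (i <= k < j)%N -> g k.+1 <= g k * expR c) ->
  g j <= g i * expR ((j%:R - i%:R) * c).
Proof.
move=> ij; rewrite -(subnKC ij); elim: (j - i)%N => [_|d IH h].
  by rewrite addn0 subrr mul0r expR0 mulr1.
rewrite addnS (le_trans (h _ _)) ?ltnSn ?leq_addr// ?addnS ?ltnSn//.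
have -> : ((i + d).+1%:R - i%:R) * c = ((i + d)%:R - i%:R) * c + c.
  by rewrite -natr1; ring.
rewrite expRD mulrA ler_wpM2r ?expR_ge0// IH// => k /andP[ik kd].
by apply: h; rewrite ik addnS ltnW.
Qed.

(** * Comparison of the counts with Gaussian factors *)

Section LocalGlobal.
Context {R : realType}.
Local Notation q := (Num.sqrt 2 : R).
Local Notation mu := ((2 - q) / 4 : R).
Variables (n : nat) (a : nat -> R).
Hypothesis n_ge : (10 <= n)%N.
Hypothesis a_gt0 : forall k, (k.*2 <= n)%N -> 0 < a k.
Hypothesis a_out : forall k, (n < k.*2)%N -> a k = 0.
Hypothesis a_ratio : forall k, (k.*2 <= n)%N ->
  a k.+1 * (4 * k.+1%:R * (n%:R - k.+1%:R)) =
  a k * ((n%:R - 2 * k%:R) * (n%:R - 2 * k%:R - 1)).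

Definition dev (k : nat) : R := k%:R - mu * n%:R.
(* For [kappa = 4 * q] the Gaussian factor cancels the decay of [a] near its mode
   up to factors exp(O(1 / n)); for [kappa = 1] the product still decreases away
   from the mode, on the whole range, up to factors exp(24 / n). *)
Definition tilted (kappa : R) (k : nat) : R :=
  a k * expR (kappa * dev k ^+ 2 / n%:R).

Let n0 : 0 < n%:R :> R.
Proof. by rewrite ltr0n (leq_trans _ n_ge). Qed.

Let n10 : 10 <= n%:R :> R.
Proof. by rewrite ler_nat. Qed.

Lemma devS k : dev k.+1 = dev k + 1.
Proof. by rewrite /dev -natr1; ring. Qed.

Lemma rnum_dev k : rnum n%:R (dev k) =
  (n%:R - 2 * k%:R) * (n%:R - 2 * k%:R - 1).
Proof. by rewrite /rnum /dev; field. Qed.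

Lemma rden_dev k : rden n%:R (dev k) = 4 * k.+1%:R * (n%:R - k.+1%:R).
Proof. by rewrite /rden -devS /dev; field. Qed.

Lemma a_ratio_dev k : (k.*2 <= n)%N ->
  a k.+1 * rden n%:R (dev k) = a k * rnum n%:R (dev k).
Proof. by move=> kn; rewrite rden_dev rnum_dev a_ratio. Qed.

Lemma a_ge0 k : 0 <= a k.
Proof. by have [/a_gt0/ltW|/a_out->] := leqP k.*2 n. Qed.

Lemma tiltedS kappa k : tilted kappa k.+1 =
  a k.+1 * expR (kappa * (2 * dev k + 1) / n%:R) * expR (kappa * dev k ^+ 2 / n%:R).
Proof.
rewrite /tilted devS -[RHS]mulrA -expRD; congr (_ * expR _).
by field; exact: lt0r_neq0.
Qed.

Lemma tilted_up kappa c k : (k.*2 <= n)%N -> 0 < rden n%:R (dev k) ->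
  n%:R * (rnum n%:R (dev k) - rden n%:R (dev k)) +
    kappa * (2 * dev k + 1) * rden n%:R (dev k) <= c * rden n%:R (dev k) ->
  tilted kappa k.+1 <= tilted kappa k * expR (c / n%:R).
Proof.
move=> kn d0 le; rewrite tiltedS /tilted [leRHS]mulrAC ler_wpM2r ?expR_ge0//.
exact: ratio_expR_step (a_ge0 k) d0 n0 (a_ratio_dev kn) le.
Qed.

Lemma tilted_down kappa c k : (k.*2 <= n)%N -> 0 < rnum n%:R (dev k) ->
  n%:R * (rden n%:R (dev k) - rnum n%:R (dev k)) -
    kappa * (2 * dev k + 1) * rnum n%:R (dev k) <= c * rnum n%:R (dev k) ->
  tilted kappa k <= tilted kappa k.+1 * expR (c / n%:R).
Proof.
move=> kn d0; rewrite -[X in _ + X]mulNr => le.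
have := ratio_expR_step (a_ge0 k.+1) d0 n0 (esym (a_ratio_dev kn)) le.
rewrite mulNr expRN ler_pdivrMr ?expR_gt0// tiltedS /tilted => h.
by rewrite [leRHS]mulrAC ler_wpM2r ?expR_ge0// [leRHS]mulrAC.
Qed.

(** The bound on [dev] holds at every index between [k] and [m], so each step from [m] to [k] costs
    at most a factor exp(1000 L / n). *)
Lemma tilted_local L k m : 1 <= L -> 400 * L <= n%:R ->
  dev k ^+ 2 <= L * n%:R -> dev m ^+ 2 <= L * n%:R ->
  tilted (4 * q) k <= tilted (4 * q) m *
    expR (`|k%:R - m%:R| * (10 * (10 * (10 * L)) / n%:R)).
Proof.
move=> L1 Ln kL mL.
have nL i j l : (i <= l <= j)%N -> dev i ^+ 2 <= L * n%:R -> dev j ^+ 2 <= L * n%:R ->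
    dev l ^+ 2 <= L * n%:R.
  move=> /andP[il lj] iL jL.
  have hi : dev i <= dev l by rewrite lerB ?ler_nat.
  have hj : dev l <= dev j by rewrite lerB ?ler_nat.
  have [d0|d0] := leP 0 (dev l).
    by rewrite (le_trans _ jL)// ler_sqr ?nnegrE// (le_trans d0).
  by rewrite (le_trans _ iL)// -sqrrN -(sqrrN (dev i)) ler_sqr ?nnegrE; lra.
(* Past n / 2 the deviation is at least 3 n / 10, too much since L <= n / 400. *)
have ln l : dev l ^+ 2 <= L * n%:R -> (l.*2 <= n)%N.
  move=> lL; rewrite leqNgt; apply/negP => nl.
  have : n%:R + 1 <= 2 * l%:R :> R by rewrite natr1 -natrM ler_nat mul2n.
  have := sqrt2_gt (R := R); have := n10; rewrite /dev in lL.
  move=> h1 h2 h3.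
  have h4 : 3 / 10 * n%:R <= l%:R - mu * n%:R by nra.
  have : (3 / 10 * n%:R) ^+ 2 <= (l%:R - mu * n%:R) ^+ 2 by rewrite ler_sqr ?nnegrE; lra.
  have : L * n%:R <= n%:R / 400 * n%:R by rewrite ler_wpM2r//; lra.
  have : 0 < n%:R * n%:R :> R by rewrite mulr_gt0.
  by lra.
have n2 : 0 < n%:R ^+ 2 / 4 :> R by rewrite divr_gt0 ?exprn_gt0.
have [mk|/ltnW km] := leqP m k.
  rewrite ger0_norm ?subr_ge0 ?ler_nat//.
  apply: chain_expR => // l /andP[ml lk].
  have lL : dev l ^+ 2 <= L * n%:R by apply: (nL m k) => //; rewrite ml ltnW.
  apply: tilted_up; [exact: ln | | exact: ratio_local_up].
  exact: lt_le_trans n2 (rden_local L1 Ln lL).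
rewrite ler0_norm ?opprB ?subr_le0 ?ler_nat//.
(* Below [m] the walk descends, whence the reindexing by m - l. *)
have := @chain_expR _ (fun l => tilted (4 * q) (m - l)) (10 * (10 * (10 * L)) / n%:R) 0 (m - k) isT.
rewrite subKn// subn0 subr0 natrB//; apply => l /= lk.
have eml : (m - l = (m - l.+1).+1)%N by lia.
have lL : dev (m - l.+1) ^+ 2 <= L * n%:R by apply: (nL k m) => //; lia.
rewrite [in leRHS]eml; apply: tilted_down; [exact: ln | | exact: ratio_local_down].
exact: lt_le_trans n2 (rnum_local L1 Ln lL).
Qed.

Lemma tilted_global k m : - 1 < dev m -> dev m <= 0 -> (k.*2 <= n)%N ->
  tilted 1 k <= tilted 1 m * expR (`|k%:R - m%:R| * (24 / n%:R)).
Proof.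
move=> m1 m0 kn.
have n2 : 0 < n%:R ^+ 2 / 4 :> R by rewrite divr_gt0 ?exprn_gt0.
have dev_le i j : (i <= j)%N -> dev i <= dev j by move=> ij; rewrite lerB ?ler_nat.
have [mk|/ltnW km] := leqP m k.
  rewrite ger0_norm ?subr_ge0 ?ler_nat//.
  apply: chain_expR => // l /andP[ml lk].
  have l1 : -1 <= dev l by rewrite (le_trans (ltW m1)) ?dev_le.
  have l2 : dev l + 1 <= n%:R * q / 4.
    rewrite -devS (le_trans (dev_le _ _ lk))// /dev.
    have : 2 * k%:R <= n%:R :> R by rewrite -natrM ler_nat mul2n.
    by lra.
  apply: tilted_up; [by rewrite (leq_trans _ kn)// leq_double ltnW | | ].
    exact: lt_le_trans n2 (rden_global n10 l1 l2).
  by rewrite mul1r; exact: ratio_global_up.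
rewrite ler0_norm ?opprB ?subr_le0 ?ler_nat//.
have := @chain_expR _ (fun l => tilted 1 (m - l)) (24 / n%:R) 0 (m - k) isT.
rewrite subKn// subn0 subr0 natrB//; apply => l /= lk.
have eml : (m - l = (m - l.+1).+1)%N by lia.
have l1 : dev (m - l.+1) <= 0 by rewrite (le_trans _ m0)// dev_le// leq_subr.
have l2 : - (mu * n%:R) <= dev (m - l.+1) by rewrite /dev lerDr ler0n.
have mn : (m.*2 <= n)%N.
  rewrite -(ler_nat R) -mul2n natrM; have := sqrt2_gt (R := R); move: m0; rewrite /dev.
  by have := n10; nra.
rewrite [in leRHS]eml; apply: tilted_down.
- by rewrite (leq_trans _ mn)// leq_double leq_subr.
- exact: lt_le_trans n2 (rnum_global n10 l1).
- by rewrite mul1r; exact: ratio_global_down.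
Qed.

(** As |k - m| <= n, the steps of [tilted_global] cost at most exp 24 altogether; the tilt at [m]
    costs at most one more factor exp 1. *)
Lemma a_le_gauss k m : - 1 < dev m -> dev m <= 0 -> (k <= n)%N ->
  a k <= a m * (expR 25 * expR (- dev k ^+ 2 / n%:R)).
Proof.
move=> m1 m0 kn; have [k2|k2] := leqP k.*2 n; last first.
  by rewrite a_out// mulr_ge0 ?mulr_ge0 ?a_ge0 ?expR_ge0.
have mn : (m <= n)%N.
  rewrite -(ler_nat R); have := sqrt2_gt (R := R); move: m0; rewrite /dev.
  by have := n10; nra.
have := tilted_global m1 m0 k2; rewrite /tilted !mul1r => h.
rewrite mulNr expRN mulrA ler_pdivlMr ?expR_gt0// (le_trans h)//.
rewrite -mulrA ler_wpM2l ?a_ge0// -expRD ler_expR.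
have : dev m ^+ 2 / n%:R <= 1.
  by rewrite ler_pdivrMr// mul1r; have := n10; nra.
have : `|k%:R - m%:R| * (24 / n%:R) <= 24 :> R.
  rewrite mulrA ler_pdivrMr// mulrC ler_wpM2l// ler_norml.
  have := ler0n R k; have := ler0n R m.
  move: kn mn; rewrite -!(ler_nat R) => h1 h2 h3 h4.
  by apply/andP; split; lra.
by lra.
Qed.

End LocalGlobal.

(** * Local limit theorem *)

Section LocalLimit.
Local Open Scope classical_set_scope.
Context {R : realType}.
Local Notation q := (Num.sqrt 2 : R).
Local Notation mu := ((2 - q) / 4 : R).
Local Notation sigma := (2 `^ 4^-1 / 4 : R).
Local Notation scale n := (Num.sqrt n%:R * sigma : R).

Lemma sigma_gt0 : 0 < sigma.
Proof. by rewrite divr_gt0 ?powR_gt0. Qed.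

(** With y = t sigma sqrt n this gives 4 q y^2 / n = t^2 / 2. *)
Lemma sigma_sqr : sigma ^+ 2 = q / 16.
Proof.
rewrite expr_div_n -powR_mulrn ?powR_ge0// -powRrM.
have -> : 4^-1 * 2%:R = 2^-1 :> R by field.
by rewrite powR12_sqrt//; field.
Qed.

Lemma scale_sqr n : scale n ^+ 2 = n%:R * (q / 16).
Proof. by rewrite exprMn sigma_sqr sqr_sqrtr. Qed.

Lemma scale_gt0 n : (0 < n)%N -> 0 < scale n.
Proof. by move=> n0; rewrite mulr_gt0 ?sqrtr_gt0 ?ltr0n ?sigma_gt0. Qed.

Lemma cvg_invsqrt : (Num.sqrt n%:R)^-1 @[n --> \oo] --> (0 : R).
Proof.
have h : (n%:R)^-1 @[n --> \oo] --> (0 : R).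
  apply/gtr0_cvgV0; last exact: cvgr_idn.
  by near=> n; rewrite ltr0n; near: n; exists 1%N.
have : Num.sqrt (n%:R^-1) @[n --> \oo] --> Num.sqrt (0 : R).
  by apply: continuous_cvg; [exact: sqrt_continuous|exact: h].
rewrite sqrtr0; apply: cvg_trans; apply: near_eq_cvg.
by near=> n; rewrite sqrtrV.
Unshelve. all: by end_near.
Qed.

Definition mode (n : nat) : nat := Num.truncn (mu * n%:R).

Lemma mu_gt0 : 0 < mu.
Proof. by have := sqrt2_lt (R := R); lra. Qed.

Lemma dev_mode n : - 1 < dev n (mode n) :> R /\ dev n (mode n) <= 0 :> R.
Proof.
have /truncn_itv/andP[h1 h2] : 0 <= mu * n%:R by rewrite mulr_ge0 ?(ltW mu_gt0).
by move: h2; rewrite -natr1 /dev /mode => h2; split; lra.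
Qed.

Variable a : nat -> nat -> R.
Hypothesis a_gt0 : forall n k, (0 < n)%N -> (k.*2 <= n)%N -> 0 < a n k.
Hypothesis a_out : forall n k, (0 < n)%N -> (n < k.*2)%N -> a n k = 0.
Hypothesis a_ratio : forall n k, (0 < n)%N -> (k.*2 <= n)%N ->
  a n k.+1 * (4 * k.+1%:R * (n%:R - k.+1%:R)) =
  a n k * ((n%:R - 2 * k%:R) * (n%:R - 2 * k%:R - 1)).

Lemma mode_le n : ((mode n).*2 <= n)%N.
Proof.
rewrite -(ler_nat R) -mul2n natrM; have [_] := dev_mode n; rewrite /dev.
by have := sqrt2_gt (R := R); have := ler0n R n; nra.
Qed.

Lemma a_mode_gt0 n : (0 < n)%N -> 0 < a n (mode n).
Proof. by move=> n0; rewrite a_gt0 ?mode_le. Qed.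

(** [tilted_local], used in both directions between [k n] and [mode n], squeezes the quotient
    between exp(E - D) and exp(E + D). Here [E] is the difference of the two tilts, with limit - t^2
    / 2, and [D], of order 1 / sqrt n, is the accumulated error. *)
Lemma cvg_local (k : nat -> nat) (t : R) :
  (\forall n \near \oo, `|dev n (k n) - t * scale n| <= 1) ->
  a n (k n) / a n (mode n) @[n --> \oo] --> expR (- t ^+ 2 / 2).
Proof.
move=> hk.
pose r n : R := (Num.sqrt n%:R)^-1.
have r0 : r n @[n --> \oo] --> 0 := cvg_invsqrt.
pose u n : R := dev n (k n) * r n.
pose v n : R := dev n (mode n) * r n.
have r_ge0 n : 0 <= r n by rewrite invr_ge0.
have u_cvg : u n @[n --> \oo] --> t * sigma.
  apply: (@squeeze_cvgr _ _ _ _ (fun n => t * sigma - r n) (fun n => t * sigma + r n)).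
  - near=> n; rewrite -ler_distl.
    have n0 : (0 < n)%N by near: n; exists 1%N.
    have -> : u n - t * sigma = (dev n (k n) - t * scale n) * r n.
      have rs : Num.sqrt n%:R * r n = 1 by rewrite mulfV// lt0r_neq0// sqrtr_gt0 ltr0n.
      rewrite mulrBl /u; congr (_ - _).
      have -> : t * scale n * r n = t * sigma * (Num.sqrt n%:R * r n) by ring.
      by rewrite rs mulr1.
    rewrite normrM [X in _ * X]ger0_norm// ler_piMl//.
    by near: n.
  - by rewrite -[X in _ --> X]subr0; apply: cvgB => //; exact: cvg_cst.
  - by rewrite -[X in _ --> X]addr0; apply: cvgD => //; exact: cvg_cst.
have v_cvg : v n @[n --> \oo] --> 0.
  apply: (@squeeze_cvgr _ _ _ _ (fun n => - r n) r) => //.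
  - near=> n; rewrite -ler_norml normrM [X in _ * X]ger0_norm// ler_piMl//.
    by have [h1 h2] := @dev_mode n; rewrite ler_norml; apply/andP; split; lra.
  - by rewrite -oppr0; exact: cvgN.
(* A deviation within 1 of t [scale n] has square at most 2 (t [scale n])^2 + 2, and 2 (t
   [scale n])^2 = n t^2 q / 8. *)
pose L : R := t ^+ 2 * (q / 8) + 2.
pose C : R := 10 * (10 * (10 * L)).
have L1 : 1 <= L by rewrite /L; have := mulr_ge0 (sqr_ge0 t) (sqrtr_ge0 (2 : R)); lra.
pose E n : R := 4 * q * v n ^+ 2 - 4 * q * u n ^+ 2.
pose D n : R := `|u n - v n| * r n * C.
have E_cvg : E n @[n --> \oo] --> - t ^+ 2 / 2.
  have -> : - t ^+ 2 / 2 = 4 * q * 0 ^+ 2 - 4 * q * (t * sigma) ^+ 2.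
    rewrite exprMn sigma_sqr; have := sqrt2_sqr (R := R); move: q => p p2.
    have -> : 4 * p * 0 ^+ 2 - 4 * p * (t ^+ 2 * (p / 16)) = - t ^+ 2 * (p ^+ 2) / 4 by field.
    by rewrite p2; field.
  by apply: cvgB; apply: cvgM; [exact: cvg_cst| |exact: cvg_cst|]; exact: cvgM.
have D_cvg : D n @[n --> \oo] --> 0.
  rewrite -[X in _ --> X](mul0r C) -[X in X * C](mulr0 (`|t * sigma - 0|)).
  apply: cvgM; last exact: cvg_cst.
  by apply: cvgM => //; apply: cvg_norm; exact: cvgB.
have expE (G : nat -> R) (l : R) : G n @[n --> \oo] --> l ->
    expR (G n) @[n --> \oo] --> expR l.
  by move=> h; apply: continuous_cvg; [exact: continuous_expR|exact: h].
apply: (@squeeze_cvgr _ _ _ _ (fun n => expR (E n - D n)) (fun n => expR (E n + D n))).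
- near=> n.
  have n10 : (10 <= n)%N by near: n; exists 10%N.
  have n0 : (0 < n)%N by exact: leq_trans n10.
  have nL : 400 * L <= n%:R by near: n; exact: nbhs_infty_ger.
  have kn : `|dev n (k n) - t * scale n| <= 1 by near: n.
  have n1 : 1 <= n%:R :> R by rewrite ler1n.
  have kL : dev n (k n) ^+ 2 <= L * n%:R.
    have : (t * scale n) ^+ 2 = t ^+ 2 * (n%:R * (q / 16)) by rewrite exprMn scale_sqr.
    move: kn; rewrite ler_norml; move: (dev n (k n)) (t * scale n) => d e /andP[d1 d2] ee.
    have : (d - e) ^+ 2 <= 1 by nra.
    have := sqr_ge0 (d - 2 * e); rewrite /L; lra.
  have mL : dev n (mode n) ^+ 2 <= L * n%:R.
    have [h1 h2] := dev_mode n.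
    apply: (@le_trans _ _ 1); first by nra.
    by rewrite -[leLHS]mul1r ler_pM.
  have am := a_mode_gt0 n0.
  have rn : r n ^+ 2 = n%:R^-1 by rewrite exprVn sqr_sqrtr.
  have DE : `|(k n)%:R - (mode n)%:R| * (C / n%:R) = D n.
    have -> : (k n)%:R - (mode n)%:R = dev n (k n) - dev n (mode n) :> R.
      by rewrite /dev; ring.
    rewrite /D -mulrBl normrM [`|r n|]ger0_norm// -rn; ring.
  have EE : E n = 4 * q * dev n (mode n) ^+ 2 / n%:R - 4 * q * dev n (k n) ^+ 2 / n%:R.
    by rewrite /E /u /v -rn; ring.
  have h1 := tilted_local n10 (fun k => @a_gt0 n k n0) (fun k => @a_out n k n0)
    (fun k => @a_ratio n k n0) L1 nL kL mL.
  have h2 := tilted_local n10 (fun k => @a_gt0 n k n0) (fun k => @a_out n k n0)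
    (fun k => @a_ratio n k n0) L1 nL mL kL.
  rewrite -/C DE /tilted in h1; rewrite -/C distrC DE /tilted in h2.
  apply/andP; split.
    rewrite ler_pdivlMr// [leLHS]mulrC.
    rewrite -(ler_pM2r (expR_gt0 (4 * q * dev n (k n) ^+ 2 / n%:R + D n))).
    rewrite -[leLHS]mulrA -expRD.
    have -> : E n - D n + (4 * q * dev n (k n) ^+ 2 / n%:R + D n) =
      4 * q * dev n (mode n) ^+ 2 / n%:R by rewrite EE; ring.
    by rewrite (le_trans h2)// -mulrA -expRD.
  rewrite ler_pdivrMr// [leRHS]mulrC.
  rewrite -(ler_pM2r (expR_gt0 (4 * q * dev n (k n) ^+ 2 / n%:R))) -[leRHS]mulrA.
  rewrite (le_trans h1)// -mulrA -!expRD ler_pM2l// ler_expR EE; lra.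
- by apply: expE; rewrite -[X in _ --> X]subr0; exact: cvgB.
- by apply: expE; rewrite -[X in _ --> X]addr0; exact: cvgD.
Unshelve. all: by end_near.
Qed.

End LocalLimit.

(** * Dominated convergence and the limit law *)

Section StepFunction.
Local Open Scope classical_set_scope.
Context {R : realType}.
Local Notation q := (Num.sqrt 2 : R).
Local Notation mu := ((2 - q) / 4 : R).
Local Notation sigma := (2 `^ 4^-1 / 4 : R).
Local Notation scale n := (Num.sqrt n%:R * sigma : R).
Local Notation lebesgue := (@lebesgue_measure R).

Variable a : nat -> nat -> R.
Hypothesis a_gt0 : forall n k, (0 < n)%N -> (k.*2 <= n)%N -> 0 < a n k.
Hypothesis a_out : forall n k, (0 < n)%N -> (n < k.*2)%N -> a n k = 0.
Hypothesis a_ratio : forall n k, (0 < n)%N -> (k.*2 <= n)%N ->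
  a n k.+1 * (4 * k.+1%:R * (n%:R - k.+1%:R)) =
  a n k * ((n%:R - 2 * k%:R) * (n%:R - 2 * k%:R - 1)).

Definition cell (n k : nat) : set R := `[dev n k / scale n, dev n k.+1 / scale n[.

Definition rel_weight (n k : nat) : R := a n k / a n (@mode R n).

(** Its integral is the sum of the selected relative weights divided by [scale n]. [S] will select
    the heights counted by the distribution function at a point, or all heights. *)
Definition stepfun (S : nat -> bool) (n : nat) (t : R) : R :=
  \sum_(k < n.+1 | S k) rel_weight n k * \1_(cell n k) t.

Lemma cellE n k t : (0 < n)%N ->
  cell n k t = (dev n k <= t * scale n < dev n k + 1) :> Prop.
Proof.
move=> n0; rewrite /cell set_itvco devS /mkset.
by rewrite ler_pdivrMr ?scale_gt0// ltr_pdivlMr ?scale_gt0.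
Qed.

Lemma cell_uniq n k l t : (0 < n)%N -> cell n k t -> cell n l t -> k = l.
Proof.
move=> n0; rewrite !cellE// /dev => /andP[h1 h2] /andP[h3 h4].
by apply/eqP; rewrite eqn_leq; apply/andP; split; rewrite -ltnS -(ltr_nat R) -natr1; lra.
Qed.

Lemma stepfunE S n k t : (0 < n)%N -> (k <= n)%N -> cell n k t ->
  stepfun S n t = (S k)%:R * rel_weight n k.
Proof.
move=> n0 kn tk; rewrite /stepfun; case: (boolP (S k)) => Sk; last first.
  rewrite mul0r big1// => l Sl; rewrite indicE memNset ?mulr0// => tl.
  by rewrite (cell_uniq n0 tk tl) Sl in Sk.
have kn1 : (k < n.+1)%N by [].
rewrite (bigD1 (Ordinal kn1))//= indicE mem_set// mulr1 mul1r big1 ?addr0// => l /andP[Sl lk].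
rewrite indicE memNset ?mulr0// => tl; move: lk; rewrite -val_eqE /=.
by rewrite (cell_uniq n0 tk tl) eqxx.
Qed.

Lemma stepfun_out S n t : (forall k, (k <= n)%N -> ~ cell n k t) ->
  stepfun S n t = 0.
Proof.
move=> h; rewrite /stepfun big1// => l _.
by rewrite indicE memNset ?mulr0//; apply: h; rewrite -ltnS.
Qed.

Lemma rel_weight_ge0 n k : (0 < n)%N -> 0 <= rel_weight n k.
Proof.
move=> n0; rewrite divr_ge0 ?(ltW (a_mode_gt0 a_gt0 n0))//.
by have [kn|kn] := leqP k.*2 n; [rewrite ltW ?a_gt0|rewrite a_out].
Qed.

Lemma stepfun_ge0 S n t : (0 < n)%N -> 0 <= stepfun S n t.
Proof.
by move=> n0; apply: sumr_ge0 => k _; rewrite mulr_ge0 ?rel_weight_ge0// indicE.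
Qed.

Lemma measurable_cell n k : measurable (cell n k).
Proof. exact: measurable_itv. Qed.

Lemma measurable_stepfun S n : measurable_fun [set: R] (stepfun S n).
Proof.
rewrite /stepfun; under eq_fun do rewrite big_mkcond/=.
apply: measurable_sum => k; case: (S k); last exact: measurable_cst.
by apply: measurable_funM => //; apply: measurable_indic; exact: measurable_cell.
Qed.

(** On the cell of k, (t [scale n])^2 <= 2 dev^2 + 2, hence t^2 / 32 <= dev^2 / n + 1. The bound of
    [a_le_gauss], with constant exp 25, becomes one with constant exp 26 and standard deviation
    4. *)
Lemma stepfun_le_gauss S n t : (10 <= n)%N ->
  stepfun S n t <= expR 26 * normal_fun 0 4 t.
Proof.
move=> n10; have n0 : (0 < n)%N by exact: leq_trans n10.
have [[k [kn tk]]|] := pselect (exists k, (k <= n)%N /\ cell n k t); last first.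
  move=> /forallNP h; rewrite stepfun_out ?mulr_ge0 ?expR_ge0 ?normal_fun_ge0//.
  by move=> k kn tk; apply: (h k).
rewrite (stepfunE _ n0 kn tk).
apply: (@le_trans _ _ (rel_weight n k)).
  by case: (S k); rewrite ?mul1r// mul0r rel_weight_ge0.
have [m1 m2] := @dev_mode R n.
have := a_le_gauss n10 (fun k => @a_gt0 n k n0) (fun k => @a_out n k n0)
  (fun k => @a_ratio n k n0) m1 m2 kn.
rewrite mulrC -ler_pdivrMr ?(a_mode_gt0 a_gt0)// => /le_trans; apply.
rewrite -expRD /normal_fun -expRD ler_expR subr0.
move: tk; rewrite cellE// => /andP[t1 t2].
have n1 : 10 <= n%:R :> R by rewrite ler_nat.
have s2 := scale_sqr (R := R) n.
have h : n%:R * (q / 16) * t ^+ 2 <= 2 * dev n k ^+ 2 + 2.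
  rewrite -s2 -exprMn [_ * t]mulrC; move: (t * _) (dev n k) t1 t2 => x y h1 h2.
  by have := sqr_ge0 (y - (x - y)); nra.
have h3 : t ^+ 2 / 32 <= dev n k ^+ 2 / n%:R + 1 / n%:R.
  rewrite -mulrDl ler_pdivlMr ?ltr0n//.
  have := sqrt2_gt (R := R); have := sqr_ge0 t => t0 q1.
  have : n%:R * t ^+ 2 * 1 <= n%:R * t ^+ 2 * q.
    by apply: ler_wpM2l; [rewrite mulr_ge0 | lra].
  lra.
have h4 : 1 / n%:R <= 1 :> R by rewrite ler_pdivrMr ?ltr0n//; lra.
have -> : 4 ^+ 2 *+ 2 = 32 :> R by rewrite -mulr_natr; ring.
rewrite !mulNr; lra.
Qed.

Lemma lebesgue_cell n k : (0 < n)%N ->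
  lebesgue_measure (cell n k) = ((scale n)^-1)%:E.
Proof.
move=> n0; rewrite /cell lebesgue_measure_itv /= lte_fin.
rewrite ltr_pM2r ?invr_gt0 ?scale_gt0// devS ltrDl ltr01 -EFinB; congr (_%:E).
by rewrite -mulrBl [dev n k + 1]addrC addrK mul1r.
Qed.

Lemma integral_stepfun S n : (0 < n)%N ->
  (\int[lebesgue]_t (stepfun S n t)%:E =
   (\sum_(k < n.+1 | S k) rel_weight n k / scale n)%:E)%E.
Proof.
move=> n0; rewrite /stepfun.
under eq_integral do rewrite -sumEFin big_mkcond /=.
rewrite ge0_integral_sum//; last 2 first.
- move=> k; case: (S k); last exact: measurable_cst.
  apply/measurable_EFinP.
  by apply: measurable_funM => //; apply: measurable_indic; exact: measurable_cell.
- by move=> k t _; case: (S k) => //; rewrite lee_fin mulr_ge0 ?rel_weight_ge0// indicE.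
rewrite -sumEFin [RHS]big_mkcond /=; apply: eq_bigr => k _.
case: (S k); last by rewrite integral0.
under eq_integral do rewrite EFinM.
rewrite ge0_integralZl_EFin ?rel_weight_ge0//; last first.
  by apply/measurable_EFinP; apply: measurable_indic; exact: measurable_cell.
rewrite integral_indic//; last exact: measurable_cell.
by rewrite setIT [RHS]EFinM; congr (_ * _)%E; exact: lebesgue_cell.
Qed.

Definition cell_index (t : R) (n : nat) : nat := Num.truncn (mu * n%:R + t * scale n).

(** [scale n] grows like sqrt n, so eventually mu n + t [scale n] lies between 0 and 2 mu n, and 2
    mu < 1. *)
Lemma cell_near t : \forall n \near \oo,
  (cell_index t n <= n)%N /\ cell n (cell_index t n) t.
Proof.
have m0 := mu_gt0 (R := R).
near=> n.
have n0 : (0 < n)%N by near: n; exists 1%N.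
have ts : `|t| * scale n <= mu * n%:R.
  have : (`|t| * sigma / mu) ^+ 2 <= n%:R by near: n; exact: nbhs_infty_ger.
  rewrite -[n%:R in X in X -> _](@sqr_sqrtr R)// ler_sqr ?nnegrE ?sqrtr_ge0//; last first.
    apply: divr_ge0; last exact: ltW.
    by apply: mulr_ge0 => //; apply/ltW/sigma_gt0.
  rewrite ler_pdivrMr// => h.
  have -> : `|t| * scale n = Num.sqrt n%:R * (`|t| * sigma) by ring.
  rewrite (le_trans (ler_wpM2l (sqrtr_ge0 (n%:R : R)) h))//.
  by rewrite [X in _ * X]mulrC mulrCA -expr2 sqr_sqrtr.
have s0 := scale_gt0 (R := R) n0.
have : - (`|t| * scale n) <= t * scale n <= `|t| * scale n.
  by rewrite -ler_norml normrM [`|scale n|]gtr0_norm.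
move=> /andP[t1 t2].
have /truncn_itv/andP[k1 k2] : 0 <= mu * n%:R + t * scale n by lra.
rewrite -/(cell_index t n) in k1 k2; split.
  rewrite -(ler_nat R) (le_trans k1)//.
  have := sqrt2_gt (R := R) => q1; have : 0 <= n%:R :> R by []; nra.
rewrite cellE// /dev; rewrite -natr1 in k2.
by apply/andP; split; lra.
Unshelve. all: by end_near.
Qed.

(** At t only the cell of [cell_index t n] contributes, and its [dev] is within 1 of t [scale n], as
    [cvg_local] requires. *)
Lemma cvg_stepfun (S : nat -> nat -> bool) (b : bool) t :
  (\forall n \near \oo, forall k, cell n k t -> S n k = b) ->
  stepfun (S n) n t @[n --> \oo] --> b%:R * normal_fun 0 1 t.
Proof.
move=> hS; pose k := cell_index t.
have : b%:R * rel_weight n (k n) @[n --> \oo] --> b%:R * normal_fun 0 1 t.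
  apply: cvgM; first exact: cvg_cst.
  have -> : normal_fun 0 1 t = expR (- t ^+ 2 / 2) by rewrite /normal_fun subr0 expr1n.
  apply: (cvg_local a_gt0 a_out a_ratio); near=> n.
  have n0 : (0 < n)%N by near: n; exists 1%N.
  have [_] : (k n <= n)%N /\ cell n (k n) t by near: n; exact: cell_near.
  by rewrite cellE// ler_norml => /andP[h1 h2]; apply/andP; split; lra.
apply: cvg_trans; apply: near_eq_cvg; near=> n.
have n0 : (0 < n)%N by near: n; exists 1%N.
have [kn ct] : (k n <= n)%N /\ cell n (k n) t by near: n; exact: cell_near.
rewrite (stepfunE _ n0 kn ct); congr ((nat_of_bool _)%:R * _).
by apply/esym; move: (k n) ct; near: n.
Unshelve. all: by end_near.
Qed.

(** Dominated convergence for the step functions; the point [x], where the selection may fail to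
    settle, is negligible. *)
Lemma cvg_sum_gauss (S : nat -> nat -> bool) (X : set R) (x : R) : measurable X ->
  (forall t, t != x -> \forall n \near \oo, forall k, cell n k t -> S n k = (t \in X)) ->
  (normal_peak 1 * \sum_(k < n.+1 | S n k) rel_weight n k / scale n)%:E @[n --> \oo]
    --> normal_prob 0 1 X.
Proof.
move=> mX hS.
have p0 : 0 <= normal_peak 1 :> R := normal_peak_ge0 1.
(* The Gaussian domination is available from n = 10 on, hence the shift. *)
pose f_ n t := (normal_peak 1 * stepfun (S (n + 10)%N) (n + 10)%N t)%:E.
pose f t := (normal_pdf 0 1 t * \1_X t)%:E.
pose g (t : R) := ((normal_peak 1 * expR 26 / normal_peak 4)%:E * (normal_pdf 0 4 t)%:E)%E.
have [] // := @dominated_convergence _ _ R lebesgue setT measurableT f_ f g.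
- move=> n; apply/measurable_EFinP; apply: measurable_funM; first exact: measurable_cst.
  exact: measurable_stepfun.
- apply/measurable_EFinP; apply: measurable_funM; first exact: measurable_normal_pdf.
  exact: measurable_indic.
- exists [set x]; split => //; first exact: lebesgue_measure_set1.
  move=> t /= ft; apply: contrapT => /eqP tx; apply: ft => _.
  apply: cvg_EFin; first by near=> n.
  rewrite normal_pdfE ?oner_eq0// -mulrA.
  rewrite (_ : _ \o _ = fun n => normal_peak 1 * stepfun (S (n + 10)%N) (n + 10)%N t)//.
  apply: cvgM; first exact: cvg_cst.
  rewrite (cvg_shiftn 10 (fun n => stepfun (S n) n t)) indicE mulrC.
  exact: cvg_stepfun (hS _ tx).
- apply: integrableZl => //; exact: integrable_normal_pdf.
- apply: aeW => t n _; rewrite /f_ /g.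
  have n10 : (10 <= n + 10)%N by rewrite leq_addl.
  have n0 : (0 < n + 10)%N by rewrite addnS.
  rewrite abse_EFin ger0_norm ?mulr_ge0 ?stepfun_ge0//.
  rewrite -EFinM lee_fin normal_pdfE ?pnatr_eq0//.
  rewrite mulrA divfK ?gt_eqF ?normal_peak_gt0 ?pnatr_eq0// -mulrA ler_wpM2l//.
  exact: stepfun_le_gauss.
move=> _ _.
have -> : (\int[lebesgue]_t f t)%E = normal_prob 0 1 X.
  rewrite /normal_prob [RHS]integral_mkcond; apply: eq_integral => t _.
  rewrite /f /patch indicE; case: (t \in X); first by rewrite mulr1.
  by rewrite mulr0.
rewrite (_ : [sequence _]_n = [sequence
   ((normal_peak 1 * \sum_(k < (n + 10)%N.+1 | S (n + 10)%N k)
     rel_weight (n + 10)%N k / scale (n + 10)%N)%:E)]_n); last first.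
  apply/funext => n /=; have n0 : (0 < n + 10)%N by rewrite addnS.
  rewrite /f_; under eq_integral do rewrite EFinM.
  rewrite ge0_integralZl_EFin//.
  - by rewrite integral_stepfun.
  - by move=> t _; rewrite lee_fin stepfun_ge0.
  - by apply/measurable_EFinP; exact: measurable_stepfun.
by rewrite (cvg_shiftn 10 (fun n => (normal_peak 1 * \sum_(k < n.+1 | S n k)
     rel_weight n k / scale n)%:E)).
Unshelve. all: by end_near.
Qed.

End StepFunction.

(** * Law of the height of a uniform boolean interval *)

Section HeightLaw.
Local Open Scope classical_set_scope.
Context {R : realType}.
Local Notation q := (Num.sqrt 2 : R).
Local Notation sigma := (2 `^ 4^-1 / 4 : R).
Local Notation scale n := (Num.sqrt n%:R * sigma : R).

(** Words coding paths of semilength [n] have length [n.-1]; the value at n = 0 carries no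
    meaning. *)
Definition weight (n k : nat) : R := (siteW true n.-1 k)%:R.

Lemma weight_gt0 n k : (0 < n)%N -> (k.*2 <= n)%N -> 0 < weight n k.
Proof. by case: n => // n _ kn; rewrite ltr0n siteW_gt0. Qed.

Lemma weight_out n k : (0 < n)%N -> (n < k.*2)%N -> weight n k = 0.
Proof. by case: n => // n _ kn; rewrite /weight siteW_small. Qed.

Lemma weight_ratio n k : (0 < n)%N -> (k.*2 <= n)%N ->
  weight n k.+1 * (4 * k.+1%:R * (n%:R - k.+1%:R)) =
  weight n k * ((n%:R - 2 * k%:R) * (n%:R - 2 * k%:R - 1)).
Proof.
case: n => // N _ kn; rewrite /weight [N.+1.-1]/=.
have kN : (k.+1 <= N.+1)%N by lia.
have := siteW_ratio kn => /(congr1 (fun m => m%:R : R)).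
rewrite !natrM [(N.+1 - k.+1)%:R]natrB// [(N.+1 - k.*2)%:R]natrB// => e.
(* At 2k = N + 1 the second factor is 0 by truncated subtraction but -1 over the reals; the first
   factor vanishes there. *)
have e2 : (N.+1%:R - k.*2%:R) * (N.+1 - k.*2.+1)%:R =
    (N.+1%:R - 2 * k%:R) * (N.+1%:R - 2 * k%:R - 1) :> R.
  have [lt|ge] := ltnP k.*2 N.+1.
    by rewrite natrB// -natr1 -mul2n natrM; ring.
  have -> : N.+1 = k.*2 by lia.
  by rewrite -mul2n natrM subrr !mul0r.
rewrite e2 in e.
by rewrite mulrC e mulrC.
Qed.

Lemma distribution_finite d (T : measurableType d) (S : finType) (P : probability T R)
    (B : {RV P >-> {set S}}) (A : pred {set S}) :
  distribution P B [set I | A I] = (\sum_(I | A I) distribution P B [set I])%E.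
Proof.
have <- : \bigcup_(I in [set I | A I]) [set I] = [set I | A I].
  by apply/seteqP; split=> [I [J AJ ->]//|I AI]; exists I.
rewrite measure_fin_bigcup//; last 2 first.
- exact: finite_finset.
- by move=> I J _ _ [K [-> ->]].
rewrite (fsbigE (enum A)) ?enum_uniq//.
- rewrite -big_enum /= big_seq_cond [RHS]big_seq_cond; apply: eq_bigl => I.
  rewrite mem_enum andbT; case: (boolP (I \in A)) => //= AI.
  by rewrite mem_set.
- by move=> I /=; rewrite mem_enum.
- by move=> I AI; rewrite mem_enum unfold_in AI.
Qed.

Lemma card_heights N k :
  #|[set I in boolean_intervals (Finf N.+1) | height I == k]%SET| = siteW true N k.
Proof.
rewrite sum_boolean_height /siteW; apply: eq_bigr => x _.
by have := count_wsite x; rewrite size_tuple => ->.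
Qed.

Lemma sum_by_height n (F : nat -> R) : (0 < n)%N ->
  \sum_(I in boolean_intervals (Finf n)) F (height I) =
  \sum_(k < n.+1) weight n k * F k.
Proof.
case: n => // N _.
(* The count vanishes at heights above N + 1, so [inord] loses nothing. *)
have hI (I : {set Finf N.+1}) : I \in boolean_intervals (Finf N.+1) -> (height I < N.+2)%N.
  move=> IE; rewrite ltnNge; apply/negP => hN.
  have : (0 < #|[set J in boolean_intervals (Finf N.+1) | height J == height I]%SET|)%N.
    by apply/card_gt0P; exists I; rewrite inE IE eqxx.
  by rewrite card_heights siteW_small//; lia.
rewrite (partition_big (fun I => inord (height I) : 'I_N.+2) xpredT)//=.
apply: eq_bigr => k _; rewrite /weight /= -card_heights.
under eq_bigr => I /andP[IE /eqP kI].
  have -> : height I = k by rewrite -kI inordK// hI.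
  over.
rewrite sumr_const mulr_natl; congr (_ *+ _).
apply: eq_card => I; rewrite [RHS]finset.in_set.
rewrite -[LHS]/((I \in boolean_intervals (Finf N.+1)) && (inord (height I) == k :> 'I_N.+2)).
case: (boolP (I \in _)) => //= IE.
by rewrite -(inj_eq val_inj) /= inordK// hI.
Qed.

Lemma cdf_height n d (T : measurableType d) (P : probability T R)
    (B : {RV P >-> {set Finf n}}) (x : R) : (0 < n)%N ->
  uniform_over B (boolean_intervals (Finf n)) ->
  cdf (rv_map B (fun I : {set Finf n} =>
    (4 * (height I)%:R - (2 - q) * n%:R) / (Num.sqrt n%:R * 2 `^ 4^-1))) x =
  ((\sum_(k < n.+1 | dev n k <= x * scale n) weight n k) /
   (\sum_(k < n.+1) weight n k))%:E.
Proof.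
move=> n0 unif.
pose S k := dev n k <= x * scale n.
(* The denominator is 4 [scale n] and the numerator 4 [dev n k]. *)
have YE k : (4 * k%:R - (2 - q) * n%:R) / (Num.sqrt n%:R * 2 `^ 4^-1) <= x = S k :> bool.
  have -> : Num.sqrt n%:R * 2 `^ 4^-1 = 4 * scale n by field.
  rewrite ler_pdivrMr; last by apply: mulr_gt0 => //; exact: scale_gt0.
  rewrite /S /dev.
  by apply/idP/idP => h; lra.
rewrite /cdf.
rewrite [LHS](_ : _ = distribution P B [set I | S (height I)]); last first.
  rewrite /distribution /pushforward; congr (P _).
  by apply/seteqP; split=> t /=; rewrite in_itv /= YE.
rewrite (distribution_finite _ (fun I => S (height I))).
under eq_bigr do rewrite unif.
rewrite sumEFin; congr (_%:E).
rewrite -mulr_suml; congr (_ / _).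
  transitivity (\sum_(I in boolean_intervals (Finf n)) (S (height I))%:R : R).
    rewrite [LHS]big_mkcond [RHS]big_mkcond; apply: eq_bigr => I _.
    by case: (S _); case: (_ \in _).
  rewrite (sum_by_height (fun k => (S k)%:R) n0) [RHS]big_mkcond.
  by apply: eq_bigr => k _; rewrite -/(S k); case: (S k); rewrite ?mulr1 ?mulr0.
have := sum_by_height (fun _ => 1) n0; rewrite sumr_const => ->.
by apply: eq_bigr => k _; rewrite mulr1.
Qed.

(** [cvg_sum_gauss] is applied to the half-line for the numerator and to the whole line for the
    denominator; the factors [normal_peak 1], [scale n] and the weight at the mode cancel in the
    quotient. *)
Lemma cvg_height_ratio (x : R) :
  (\sum_(k < n.+1 | dev n k <= x * scale n) weight n k) /
    (\sum_(k < n.+1) weight n k) @[n --> \oo] --> fine (normal_prob 0 1 `]-oo, x]).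
Proof.
have w0 := weight_gt0; have wo := weight_out; have wr := weight_ratio.
have fin (X : set R) : measurable X -> normal_prob 0 1 X \is a fin_num.
  by move=> mX; exact: (fin_num_measure (normal_prob 0 1)).
pose Z S n := normal_peak 1 * \sum_(k < n.+1 | S n k) rel_weight weight n k / scale n.
have hS : Z (fun n k => dev n k <= x * scale n) n @[n --> \oo] -->
    fine (normal_prob 0 1 `]-oo, x]).
  have : (Z (fun n k => dev n k <= x * scale n) n)%:E @[n --> \oo] -->
     normal_prob 0 1 `]-oo, x].
    apply: (@cvg_sum_gauss R weight w0 wo wr (fun n k => dev n k <= x * scale n)
      `]-oo, x] x (measurable_itv _)) => t tx; near=> n => k.
    have n0 : (0 < n)%N by near: n; exists 1%N.
    rewrite cellE// => /andP[h1 h2]; have s0 := scale_gt0 (R := R) n0.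
    have [lt|ge] := ltP t x.
      rewrite mem_set/=; last by rewrite in_itv /= ltW.
      by apply: (le_trans h1); rewrite ler_pM2r// ltW.
    have {}ge : x < t by rewrite lt_neqAle eq_sym tx.
    rewrite memNset/=; last by rewrite in_itv /= => /(lt_le_trans ge); rewrite ltxx.
    apply/negbTE; rewrite -ltNge.
    (* For t > x the cell containing t, of length 1 / [scale n], eventually lies to the right of
       x. *)
    have : 1 <= (t - x) * scale n.
      have : (1 / ((t - x) * sigma)) ^+ 2 <= n%:R by near: n; exact: nbhs_infty_ger.
      have tx0 : 0 < (t - x) * sigma by rewrite mulr_gt0 ?sigma_gt0// subr_gt0.
      rewrite -[n%:R in X in X -> _](@sqr_sqrtr R)// ler_sqr ?nnegrE ?sqrtr_ge0//; last first.
        by apply: divr_ge0 => //; exact: ltW.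
      by rewrite ler_pdivrMr// => h; rewrite mulrCA.
    by rewrite mulrBl; lra.
  by rewrite -[X in _ --> X -> _]fineK ?fin// => /fine_cvg.
have hT : Z (fun n k => true) n @[n --> \oo] --> (1 : R).
  have : (Z (fun n k => true) n)%:E @[n --> \oo] --> (1%:E : \bar R).
    have <- : normal_prob 0 1 setT = 1%:E :> \bar R by exact: probability_setT.
    apply: (@cvg_sum_gauss R weight w0 wo wr (fun n k => true) setT 0 measurableT).
    by move=> t _; near=> n => k _; rewrite mem_setT.
  by move=> /fine_cvg.
have : Z (fun n k => dev n k <= x * scale n) n / Z (fun n k => true) n @[n --> \oo] -->
    fine (normal_prob 0 1 `]-oo, x]).
  by rewrite -[X in _ --> X]divr1; apply: cvgM => //; apply: cvgV => //; exact: oner_neq0.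
apply: cvg_trans; apply: near_eq_cvg; near=> n.
have n0 : (0 < n)%N by near: n; exists 1%N.
rewrite /Z /rel_weight -!mulr_suml.
have p0 : normal_peak 1 != 0 :> R by rewrite gt_eqF ?normal_peak_gt0 ?oner_eq0.
have s0 : scale n != 0 by rewrite gt_eqF ?scale_gt0.
have m0 : weight n (@mode R n) != 0 by rewrite gt_eqF ?(a_mode_gt0 w0).
have t0 : \sum_(k < n.+1) weight n k != 0.
  rewrite gt_eqF// (bigD1 (Ordinal (ltn0Sn n)))//= ltr_wpDr ?w0//.
  by apply: sumr_ge0 => k _; rewrite ler0n.
move: p0 s0 m0 t0; move: (normal_peak 1) (scale n) (weight n (mode n)) => p s m.
by move=> p0 s0 m0 t0; field; rewrite p0 s0 m0 t0.
Unshelve. all: by end_near.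
Qed.

Lemma cvg_height_cdf (x : R) :
  ((\sum_(k < n.+1 | dev n k <= x * scale n) weight n k) /
    (\sum_(k < n.+1) weight n k))%:E @[n --> \oo] --> normal_prob 0 1 `]-oo, x].
Proof.
rewrite -[X in _ --> X]fineK; last exact: (fin_num_measure (normal_prob 0 1)).
apply: cvg_EFin; last exact: cvg_height_ratio.
by near=> n.
Unshelve. all: by end_near.
Qed.

End HeightLaw.

Theorem theorem2p8 (R : realType)
    (d : nat -> measure_display) (T : forall n : nat, measurableType (d n))
    (P : forall n : nat, probability (T n) R)
    (B : forall n : nat, {RV (P n) >-> {set Finf n}})
    (B_unif : forall n : nat, uniform_over (B n) (boolean_intervals (Finf n))) :
  cvg_in_law
    (fun n : nat => rv_map (B n) (fun I : {set Finf n} =>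
       (4 * (height I)%:R - (2 - Num.sqrt 2) * n%:R)
       / (Num.sqrt n%:R * 2 `^ 4^-1)))
    (normal_prob 0 1).
Proof.
(* The formula of [cdf_height] is available for n > 0, which suffices for the limit. *)
move=> x _; apply: cvg_trans (@cvg_height_cdf R x); apply: near_eq_cvg; near=> n.
by rewrite cdf_height//; near: n; exists 1%N.
Unshelve. all: by end_near.
Qed.
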